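(* Let $s\in(0,1)$ and $p>1$. Let $\Omega\subset\mathbb{R}^d$, $d\ge3$, be a bounded Lipschitz domain, and let $K\subset\Omega$ be a compact set of codimension $k$ of class $C^{0,1}$, $1<k<d$, $k\in\mathbb{N}$. Assume $sp<k$ and $\alpha=d+(sp-d)\frac{\tau}{p}$. Then for any $\tau\in[p,p_s^*]$ there exists a constant $C=C(d,p,s,\tau,k,K,\Omega)>0$ such that $$\left(\int_\Omega\frac{|u(x)|^\tau}{\delta_K^\alpha(x)}\,dx\right)^{\frac1\tau}\le C\left(\int_\Omega\int_\Omega\frac{|u(x)-u(y)|^p}{|x-y|^{d+sp}}\,dx\,dy+\int_\Omega|u(x)|^p\,dx\right)^{\frac1p}\quad\text{for all }u\in W_0^{s,p}(\Omega\setminus K).$$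
   Context: Notation: $\delta_K(x)=\inf_{y\in K}|x-y|$; $p_s^*=\frac{dp}{d-sp}$ for $sp<d$. $[u]^p_{W^{s,p}(\Omega)}=\int_\Omega\int_\Omega\frac{|u(x)-u(y)|^p}{|x-y|^{d+sp}}\,dx\,dy$; $W^{s,p}(\Omega)$ is the space of $u\in L^p(\Omega)$ with $[u]_{W^{s,p}(\Omega)}<\infty$, with norm $\|u\|_{W^{s,p}(\Omega)}=\left([u]^p_{W^{s,p}(\Omega)}+\|u\|^p_{L^p(\Omega)}\right)^{1/p}$. $W^{s,p}_0(\Omega\setminus K)$ is the closure, with respect to $\|\cdot\|_{W^{s,p}(\Omega)}$, of the set of $u\in W^{s,p}(\Omega)\cap C(\Omega)$ that vanish in a neighbourhood of $K$. Class $C^{0,1}$ (for $1<k<d$): a compact surface $K$ of codimension $k$ in $\mathbb{R}^d$ is of class $C^{0,1}$ if there is $C>0$ such that for every $x\in K$ there exist a ball $B=B_r(x)\subset\mathbb{R}^d$, $r>0$, and an isomorphism $T:Q\to B$, with $Q=B_1^k(0)\times(0,1)^{d-k}$ and $B_1^k(0)$ the unit ball of $\mathbb{R}^k$ centered at $0$, such that $T\in C^{0,1}(\overline Q)$, $T^{-1}\in C^{0,1}(\overline B)$ (Lipschitz), $\|T\|_{C^{0,1}(\overline Q)}+\|T^{-1}\|_{C^{0,1}(\overline B)}\le C$, and, writing $\xi=(\xi_k,\xi_{d-k})\in Q$ with $\xi_k\in B_1^k(0)$, $\xi_{d-k}\in(0,1)^{d-k}$, one has $T^{-1}(B\cap K)=\{\xi\in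 Q:\xi_k=0\}$. It is also assumed that for any $y=T((\xi_k,\xi_{d-k}))\in(\Omega\setminus K)\cap B$ one has $C_1|\xi_k|\le\delta_K(y)\le C_2|\xi_k|$ for some $C_1,C_2>0$ very close to $1$. *)

(* Defs.v *)
(* MathComp-Analysis. R^n is 'rV[R]_n, with the library's (product) topology. *)
From HB Require Import structures.
From mathcomp Require Export all_boot all_order all_algebra.
From mathcomp Require Export all_classical all_reals all_analysis.
Export Order.TTheory GRing.Theory Num.Theory.
Export numFieldNormedType.Exports.

Set Implicit Arguments.
Unset Strict Implicit.
Unset Printing Implicit Defensive.

Local Open Scope classical_set_scope.
Local Open Scope ring_scope.

Section LebesgueMeasure.
Context {R : realType}.

(* The sigma-algebra generated by the coordinates, as for [n.-tuple R]; on R^n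
   it is the Borel sigma-algebra. *)
Section rV_measurable.
Variable n : nat.

Let coor : 'I_n -> 'rV[R]_n -> R := fun i x => x 0 i.

Let rV_set0 : g_sigma_preimage coor set0.
Proof. exact: sigma_algebra0. Qed.

Let rV_setC A : g_sigma_preimage coor A -> g_sigma_preimage coor (~` A).
Proof. exact: sigma_algebraC. Qed.

Let rV_bigcup (F : _^nat) : (forall i, g_sigma_preimage coor (F i)) ->
  g_sigma_preimage coor (\bigcup_i (F i)).
Proof. exact: sigma_algebra_bigcup. Qed.

HB.instance Definition _ := @isMeasurable.Build default_measure_display
  'rV[R]_n (g_sigma_preimage coor) rV_set0 rV_setC rV_bigcup.

End rV_measurable.

Lemma measurable_coor n (i : 'I_n) :
  measurable_fun [set: 'rV[R]_n] (fun x : 'rV[R]_n => x 0 i).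
Proof.
move=> _ Y mY; rewrite setTI; apply: sub_sigma_algebra => /=.
rewrite -bigcup_seq/=; exists i => /=; first by rewrite mem_index_enum.
by exists Y => //; rewrite setTI.
Qed.

Lemma measurable_fun_rV d (T : measurableType d) n (f : T -> 'rV[R]_n) :
  (forall i, measurable_fun [set: T] (fun x => f x 0 i)) ->
  measurable_fun [set: T] f.
Proof.
move=> mf _ A mA; rewrite setTI.
move: A mA; apply: smallest_sub.
  split.
  - by rewrite /= preimage_set0; exact: measurable0.
  - by move=> A mA; rewrite /= setTD preimage_setC; exact: measurableC.
  - by move=> F mF; rewrite /= preimage_bigcup; exact: bigcupT_measurable.
case: n f mf => [|n] f mf A; first by rewrite big_ord0.
rewrite -bigcup_mkord_ord => -[i _ [B mB <-]].
by have := mf (inord i) measurableT B mB; rewrite !setTI.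
Qed.

Definition rV_cons n (p : R * 'rV[R]_n) : 'rV[R]_n.+1 :=
  row_mx (const_mx p.1 : 'rV[R]_1) p.2.

Lemma measurable_rV_cons n : measurable_fun [set: R * 'rV[R]_n] (@rV_cons n).
Proof.
apply: measurable_fun_rV => i; rewrite /rV_cons.
case: (@split_ordP 1 n i) => j ->.
  apply: (eq_measurable_fun fst) => [[a v] _|]; last exact: measurable_fst.
  by apply: etrans (esym (row_mxEl _ _ _ _)); rewrite mxE.
apply: (eq_measurable_fun (fun x : R * 'rV[R]_n => x.2 0 j)) => [[a v] _|].
  exact: etrans (esym (row_mxEr _ _ _ _)).
exact: measurableT_comp (measurable_coor j) measurable_snd.
Qed.

Definition rV_uncons n (x : 'rV[R]_n.+1) : R * 'rV[R]_n :=
  (x 0 0, \row_j x 0 (lift 0 j)).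

Lemma rV_consK n : cancel (@rV_cons n) (@rV_uncons n).
Proof.
move=> [a v]; rewrite /rV_uncons /rV_cons; congr pair => /=.
  have -> : 0 = lshift n (0 : 'I_1) by exact/val_inj.
  by rewrite (row_mxEl (const_mx a : 'rV_1) v) mxE.
apply/rowP => j; rewrite mxE.
have -> : lift 0 j = rshift 1 j by exact/val_inj.
exact: (row_mxEr (const_mx a : 'rV_1) v).
Qed.

Lemma measurable_uncons n : measurable_fun setT (@rV_uncons n).
Proof.
apply/measurable_fun_pairP; split; first exact: measurable_coor.
apply: measurable_fun_rV => j /=.
by apply: (eq_measurable_fun (fun x : 'rV[R]_n.+1 => x 0 (lift 0 j))) => [x _|];
  [rewrite /= mxE|exact: measurable_coor].
Qed.

Section cons_measure.
Variables (n : nat) (m : {sigma_finite_measure set 'rV[R]_n -> \bar R}).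

Definition cons_measure : set 'rV[R]_n.+1 -> \bar R :=
  pushforward (@lebesgue_measure R \x m)%E (@rV_cons n).

Let cons_preimage_measurable (A : set 'rV[R]_n.+1) :
  measurable A -> measurable (@rV_cons n @^-1` A).
Proof.
by move=> mA; rewrite -[X in measurable X]setTI; exact: measurable_rV_cons.
Qed.

Let cons_measure0 : cons_measure set0 = 0%E.
Proof. by rewrite /cons_measure /pushforward preimage_set0 measure0. Qed.

Let cons_measure_ge0 A : (0 <= cons_measure A)%E.
Proof. exact: (measure_ge0 (@lebesgue_measure R \x m)%E). Qed.

Let cons_measure_sigma_additive : semi_sigma_additive cons_measure.
Proof.
move=> F mF tF mUF; rewrite /cons_measure /pushforward preimage_bigcup.
apply: measure_semi_sigma_additive.
- by move=> i; exact: cons_preimage_measurable.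
- apply/trivIsetP => /= i j _ _ ij; rewrite -preimage_setI.
  by move/trivIsetP : tF => /(_ _ _ _ _ ij) ->//; rewrite preimage_set0.
- by rewrite -preimage_bigcup; exact: cons_preimage_measurable.
Qed.

HB.instance Definition _ := isMeasure.Build _ _ _ cons_measure
  cons_measure0 cons_measure_ge0 cons_measure_sigma_additive.

Let cons_measure_sigma_finite : sigma_finite setT cons_measure.
Proof.
have [F FT Foo] : sigma_finite setT (@lebesgue_measure R \x m)%E.
  have /sigma_finiteP[F [TF ndF Foo]] := sigma_finiteT (@lebesgue_measure R).
  have /sigma_finiteP[G [TG ndG Goo]] := sigma_finiteT m.
  exists (fun i => F i `*` G i).
    rewrite -setXTT TF TG predeqE => -[x y]; split=> [[/= [i _ Fx] [k _ Gy]]|].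
      exists (maxn i k) => //; split.
      - by move: x Fx; exact/subsetPset/ndF/leq_maxl.
      - by move: y Gy; exact/subsetPset/ndG/leq_maxr.
    by move=> [i _ []/= ? ?]; split; exists i.
  move=> k; have [? ?] := Foo k; have [? ?] := Goo k.
  split; first exact: measurableX.
  by rewrite product_measure1E// lte_mul_pinfty// ge0_fin_numE.
exists (fun i => @rV_uncons n @^-1` F i).
  by rewrite -preimage_bigcup -FT preimage_setT.
move=> i; have [mF Fi] := Foo i; split.
  by rewrite -[X in measurable X]setTI; exact: measurable_uncons.
rewrite /cons_measure /pushforward -comp_preimage.
by rewrite (_ : @rV_uncons n \o _ = id)//; apply/funext => p; exact: rV_consK.
Qed.

HB.instance Definition _ := Measure_isSigmaFinite.Build _ _ _ cons_measure
  cons_measure_sigma_finite.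

End cons_measure.

(* Lebesgue measure on R^n as an iterated product; see [lebesgue_rV_box]. *)
Fixpoint lebesgue_rV n : {sigma_finite_measure set 'rV[R]_n -> \bar R} :=
  if n is n'.+1 then cons_measure (lebesgue_rV n')
  else [the {sigma_finite_measure set 'rV[R]_0 -> \bar R}
        of dirac (0 : 'rV[R]_0)].

Lemma lebesgue_rV_box n (A : 'I_n -> set R) : (forall i, measurable (A i)) ->
  lebesgue_rV n [set x | forall i, A i (x 0 i)] =
  (\prod_(i < n) lebesgue_measure (A i))%E.
Proof.
elim: n A => [|n IH] A mA.
  by rewrite big_ord0 /= diracE mem_set// => -[].
rewrite big_ord_recl /= /cons_measure /pushforward.
set B := [set x : 'rV[R]_n | forall i, A (lift 0 i) (x 0 i)].
have mB : measurable B.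
  rewrite (_ : B = \bigcap_(i in [set: 'I_n])
      ((fun x : 'rV[R]_n => x 0 i) @^-1` A (lift 0 i))).
    apply: fin_bigcap_measurable => // i _.
    by rewrite -[X in measurable X]setTI; exact: measurable_coor.
  by apply/seteqP; split => x Bx i => [_|]; [exact: Bx|exact: (Bx i I)].
rewrite (_ : _ @^-1` _ = A 0 `*` B); last first.
  have c0 p : @rV_cons n p 0 0 = p.1.
    by rewrite -[LHS]/((@rV_uncons n _).1) rV_consK.
  have cS p j : @rV_cons n p 0 (lift 0 j) = p.2 0 j.
    by have /(congr1 (fun q : R * 'rV[R]_n => q.2 0 j)) := @rV_consK n p;
      rewrite /= mxE.
  apply/seteqP; split => -[a v] /=.
    move=> h; split=> [|j]; first by have := h 0; rewrite c0.
    by have := h (lift 0 j); rewrite cS.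
  by move=> [h0 hB] i; case: (unliftP 0 i) => [j|] ->; rewrite ?c0 ?cS//; exact: hB.
transitivity (lebesgue_measure (A ord0) * lebesgue_rV n B)%E.
  by apply: product_measure1E => //; exact: mA.
by rewrite -(IH (fun i => A (lift ord0 i))) => [|i]; [|exact: mA].
Qed.

End LebesgueMeasure.

Section Geometry.
Context {R : realType}.

(* The library's norm on 'rV[R]_n is the sup norm. *)
Definition enorm n (x : 'rV[R]_n) : R := Num.sqrt (\sum_i x 0 i ^+ 2).

Definition eball n (x : 'rV[R]_n) (r : R) : set 'rV[R]_n :=
  [set y | enorm (y - x) < r].

(* Meaningful for nonempty K. *)
Definition dist_to n (K : set 'rV[R]_n) (x : 'rV[R]_n) : R :=
  inf [set enorm (x - y) | y in K].

Definition c01norm m n (D : set 'rV[R]_m) (f : 'rV[R]_m -> 'rV[R]_n) : \bar R :=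
  (ereal_sup [set (enorm (f x))%:E | x in D] +
   ereal_sup [set (enorm (f x - f y) / enorm (x - y))%:E | x in D & y in D])%E.

(* Near each boundary point, in suitable orthonormal coordinates y *m P of R^d,
   Omega is the part of a ball lying strictly above the graph of a Lipschitz
   function of the first d - 1 coordinates. *)
Definition lipschitz_boundary d (Omega : set 'rV[R]_d) : Prop :=
  forall x, (closure Omega `\` interior Omega) x ->
  exists (r L : R) (P : 'M[R]_(d, d.-1 + 1)) (phi : 'rV[R]_d.-1 -> R),
  [/\ 0 < r,
      P *m P^T = 1%:M /\ P^T *m P = 1%:M,
      forall a b, `|phi a - phi b| <= L * enorm (a - b) &
      Omega `&` eball x r =
        [set y | phi (lsubmx (y *m P)) < rsubmx (y *m P) 0 0] `&` eball x r].

Definition bounded_lipschitz_domain d (Omega : set 'rV[R]_d) : Prop :=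
  [/\ Omega !=set0, open Omega, connected Omega, bounded_set Omega &
      lipschitz_boundary Omega].

(* B_1^k(0) x (0,1)^m in R^k x R^m. *)
Definition cylinder k m : set 'rV[R]_(k + m) :=
  [set xi | enorm (lsubmx xi) < 1 /\ forall j, 0 < rsubmx xi 0 j < 1].

(* S plays the part of T^-1.  The maps are total; only their values on the
   closures of Q and B matter.  C1 and C2 are only required to be positive: the
   informal proviso that they be close to 1 carries no explicit bound. *)
Definition c01_chart d k (Omega K : set 'rV[R]_d) (C : R) (x : 'rV[R]_d) : Prop :=
  exists (r : R) (T : 'rV[R]_(k + (d - k)) -> 'rV[R]_d)
    (S : 'rV[R]_d -> 'rV[R]_(k + (d - k))),
  let Q := @cylinder k (d - k) in let B := eball x r in
  [/\ 0 < r,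
      [/\ set_bij Q B T, {in Q, cancel T S} & {in B, cancel S T}],
      (c01norm (closure Q) T + c01norm (closure B) S <= C%:E)%E,
      S @` (B `&` K) = [set xi | Q xi /\ lsubmx xi = 0] &
      exists C1 C2 : R, [/\ 0 < C1, 0 < C2 &
        forall xi, Q xi -> (Omega `\` K) (T xi) ->
          C1 * enorm (lsubmx xi) <= dist_to K (T xi) <= C2 * enorm (lsubmx xi)]].

Definition compact_c01_codim d k (Omega K : set 'rV[R]_d) : Prop :=
  [/\ K !=set0, compact K &
      exists2 C, 0 < C & forall x, K x -> c01_chart k Omega K C x].

End Geometry.

Section Sobolev.
Context {R : realType}.
Variables (d : nat) (s p : R) (Omega : set 'rV[R]_d).
Implicit Types u v : 'rV[R]_d -> R.
Local Open Scope ereal_scope.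

Definition Lp_pow u : \bar R :=
  \int[lebesgue_rV d]_(x in Omega) (`|u x| `^ p)%:E.

(* The integrand is 0 on the diagonal, as _ / 0 = 0. *)
Definition gagliardo_pow u : \bar R :=
  \int[lebesgue_rV d]_(x in Omega) \int[lebesgue_rV d]_(y in Omega)
    ((`|u x - u y| `^ p) / (enorm (x - y) `^ (d%:R + s * p)))%:E.

Definition sobolev_norm u : \bar R := (gagliardo_pow u + Lp_pow u) `^ p^-1.

Definition sobolev u : Prop :=
  [/\ measurable_fun Omega u, Lp_pow u < +oo & gagliardo_pow u < +oo].

(* W^{s,p}_0(Omega \ K) *)
Definition sobolev0 (K : set 'rV[R]_d) u : Prop :=
  sobolev u /\
  forall e : R, (0 < e)%R -> exists v,
    [/\ sobolev v, {within Omega, continuous v},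
        exists U, [/\ open U, K `<=` U & forall x, (U `&` Omega) x -> v x = 0%R] &
        sobolev_norm (u \- v)%R < e%:E].

End Sobolev.

Definition sobolev_exponent {R : realType} (d : nat) (s p : R) : R :=
  d%:R * p / (d%:R - s * p).

(* Main.v *)
(* Put q = dp/(d-sp).  For p <= tau <= q the integrand |u|^tau delta^(-alpha)
   lies, after normalization, below the sum of |u|^p delta^(-sp) and |u|^q, its
   values at tau = p and tau = q; so a fractional Hardy inequality and the
   fractional Sobolev inequality suffice.  Both hold on all of W^(s,p)(Omega)
   and rest on one remark: if |u y| <= |u x| / 2 on a portion E of a ball of
   radius t around x, then (|u x| / 2)^p |E| <= t^(d+sp) g(x), where g(x) is the
   inner Gagliardo integral.

   Sobolev: let A be the integral of |u|^q, for u bounded.  By Chebyshev's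
   inequality there is such a portion of measure about t^d (Omega satisfies an
   interior cone condition) once t^d is about A |u x|^(-q).  This gives
   |u|^q <= C A^(sp/d) g + lower order terms, which is integrated and solved
   for A.

   Hardy: the points at distance less than r from K have measure at most
   C r^k rho^(d-k) in a ball of radius rho.  Hence |u x|^p delta(x)^(-sp) is
   controlled by g(x) plus an average of |u|^p over points y with
   |x - y| < L delta(x) that are much farther from K than x.  After exchanging
   the integrals the averages cost a factor O(L^(sp-k)), which is absorbed by
   taking L large. *)
Require Import Defs.
From mathcomp Require Import ring lra measurable_realfun.

Set Implicit Arguments.
Unset Strict Implicit.
Unset Printing Implicit Defensive.

Local Open Scope classical_set_scope.
Local Open Scope ring_scope.

(** * The Euclidean norm and balls *)

Section EuclideanNorm.
Context {R : realType}.
Implicit Types n : nat.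

Lemma enorm_ge0 n (x : 'rV[R]_n) : 0 <= enorm x.
Proof. exact: sqrtr_ge0. Qed.

Lemma enorm_sqr n (x : 'rV[R]_n) : enorm x ^+ 2 = \sum_i x 0 i ^+ 2.
Proof. by rewrite sqr_sqrtr// sumr_ge0// => i _; exact: sqr_ge0. Qed.

Lemma enormN n (x : 'rV[R]_n) : enorm (- x) = enorm x.
Proof. by congr Num.sqrt; apply: eq_bigr => i _; rewrite mxE sqrrN. Qed.

Lemma enormB n (x y : 'rV[R]_n) : enorm (x - y) = enorm (y - x).
Proof. by rewrite -enormN opprB. Qed.

Lemma coord_le_enorm n (x : 'rV[R]_n) i : `|x 0 i| <= enorm x.
Proof.
rewrite -(@ler_pXn2r _ 2) ?nnegrE ?enorm_ge0// enorm_sqr real_normK ?num_real//.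
by rewrite (bigD1 i)//= lerDl sumr_ge0// => j _; exact: sqr_ge0.
Qed.

Lemma enormZ n a (x : 'rV[R]_n) : enorm (a *: x) = `|a| * enorm x.
Proof.
rewrite -sqrtr_sqr -sqrtrM ?sqr_ge0// mulr_sumr; congr Num.sqrt.
by apply: eq_bigr => i _; rewrite mxE exprMn.
Qed.

Lemma enorm0 n : enorm (0 : 'rV[R]_n) = 0.
Proof.
by rewrite /enorm big1 ?sqrtr0// => i _; rewrite mxE expr0n.
Qed.

Lemma enorm_eq0 n (x : 'rV[R]_n) : enorm x = 0 -> x = 0.
Proof.
move=> x0; apply/rowP => i; rewrite mxE; apply/eqP; rewrite -normr_eq0.
by rewrite eq_le normr_ge0 andbT -x0 coord_le_enorm.
Qed.

(** Cauchy-Schwarz: the squares of [x 0 i * b - y 0 i * a], with [a] and [b] the norms of [x] and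
    [y], add up to [2 * a * b * (a * b - S)]. *)
Lemma sum_mul_le_enorm n (x y : 'rV[R]_n) :
  \sum_i x 0 i * y 0 i <= enorm x * enorm y.
Proof.
have [x0|x0] := eqVneq (enorm x) 0.
  by rewrite (enorm_eq0 x0) enorm0 mul0r big1// => i _; rewrite mxE mul0r.
have [y0|y0] := eqVneq (enorm y) 0.
  by rewrite (enorm_eq0 y0) enorm0 mulr0 big1// => i _; rewrite mxE mulr0.
set a := enorm x; set b := enorm y.
have a0 : 0 < a by rewrite lt_def x0 enorm_ge0.
have b0 : 0 < b by rewrite lt_def y0 enorm_ge0.
have : 0 <= \sum_i (x 0 i * b - y 0 i * a) ^+ 2.
  by rewrite sumr_ge0// => i _; exact: sqr_ge0.
rewrite (eq_bigr (fun i => b ^+ 2 * x 0 i ^+ 2 + a ^+ 2 * y 0 i ^+ 2 -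
  (a * b *+ 2) * (x 0 i * y 0 i))); last by move=> i _; ring.
rewrite big_split big_split/= sumrN -!mulr_sumr -!enorm_sqr -/a -/b.
set S := \sum_i _.
rewrite (_ : _ - _ = (a * b *+ 2) * (a * b - S)); last by ring.
by rewrite pmulr_rge0 ?subr_ge0// pmulrn_lgt0// mulr_gt0.
Qed.

Lemma enormD n (x y : 'rV[R]_n) : enorm (x + y) <= enorm x + enorm y.
Proof.
rewrite -(@ler_pXn2r _ 2) ?nnegrE ?addr_ge0 ?enorm_ge0// sqrrD !enorm_sqr.
rewrite (eq_bigr (fun i => x 0 i ^+ 2 + (x 0 i * y 0 i) *+ 2 + y 0 i ^+ 2)).
  rewrite big_split big_split/= sumrMnl.
  by rewrite lerD2r lerD2l lerMn2r sum_mul_le_enorm.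
by move=> i _; rewrite mxE sqrrD.
Qed.

Lemma enorm_triangle n (y x z : 'rV[R]_n) :
  enorm (x - z) <= enorm (x - y) + enorm (y - z).
Proof. by rewrite -{1}(subrK y x) -addrA enormD. Qed.

Lemma enorm_le_coord n (x : 'rV[R]_n) r : 0 <= r ->
  (forall i, `|x 0 i| <= r) -> enorm x <= n%:R * r.
Proof.
case: n x => [|n] x r0 xr.
  by rewrite (_ : x = 0) ?enorm0 ?mul0r//; apply/rowP => -[].
rewrite -(@ler_pXn2r _ 2) ?nnegrE ?mulr_ge0 ?enorm_ge0// enorm_sqr.
apply: (@le_trans _ _ (\sum_(i < n.+1) r ^+ 2)).
  apply: ler_sum => i _; rewrite -real_normK ?num_real//.
  by rewrite ler_pXn2r ?nnegrE.
rewrite sumr_const card_ord -[leLHS]mulr_natl exprMn ler_wpM2r ?sqr_ge0//.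
by rewrite -natrX ler_nat leq_pmulr.
Qed.

Lemma enorm_le_norm n (x : 'rV[R]_n) : enorm x <= n%:R * `|x|.
Proof.
apply: enorm_le_coord => // i; rewrite /Num.norm/= mx_normrE.
by apply/bigmax_geP; right => /=; exists (0, i).
Qed.

Lemma enorm_orthogonal m n (P : 'M[R]_(m, n)) (x : 'rV[R]_m) :
  P *m P^T = 1%:M -> enorm (x *m P) = enorm x.
Proof.
move=> PP; have sqE l (y : 'rV[R]_l) : \sum_i y 0 i ^+ 2 = (y *m y^T) 0 0.
  by rewrite mxE; apply: eq_bigr => i _; rewrite mxE.
by rewrite /enorm !sqE trmx_mul mulmxA -(mulmxA x) PP mulmx1.
Qed.

Lemma eballxx n (x : 'rV[R]_n) r : 0 < r -> eball x r x.
Proof. by rewrite /eball/= subrr enorm0. Qed.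

Lemma nbhs_eball n (x : 'rV[R]_n) r : 0 < r -> nbhs x (eball x r).
Proof.
move=> r0; apply/nbhs_ballP; exists (r / n.+1%:R); first by rewrite /= divr_gt0.
move=> y; rewrite mx_norm_ball /ball_ /= -normrN opprB ltr_pdivlMr// => xy.
apply: le_lt_trans (enorm_le_norm _) _; apply: le_lt_trans xy.
by rewrite mulrC ler_wpM2l// ler_nat.
Qed.

Lemma eball_sub n (x y : 'rV[R]_n) r s : enorm (y - x) + s <= r ->
  eball y s `<=` eball x r.
Proof.
move=> yr z; rewrite /eball/= => zs; apply: lt_le_trans yr.
by apply: le_lt_trans (enorm_triangle y _ _) _; rewrite addrC ltrD2l.
Qed.

Lemma open_eball n (x : 'rV[R]_n) r : open (eball x r).
Proof.
rewrite openE => y xy; rewrite /interior.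
apply: (@filterS _ _ _ (eball y (r - enorm (y - x)))).
  by apply: eball_sub; rewrite addrC subrK.
by apply: nbhs_eball; rewrite subr_gt0.
Qed.

Lemma open_eballP n (U : set 'rV[R]_n) x : open U -> U x ->
  exists2 r, 0 < r & eball x r `<=` U.
Proof.
move=> oU Ux; have /nbhs_ballP[e /= e0 eU] : nbhs x U by exact: open_nbhs_nbhs.
exists e => // y xy; apply: eU; split=> // i j; rewrite ord1.
apply: le_lt_trans xy; rewrite /ball_/= enormB.
by apply: le_trans (coord_le_enorm _ j); rewrite !mxE.
Qed.

(** The sigma-algebra is generated by the coordinates, so an open set is exhausted by countably many
    cubes with rational centre and half-side, each of them a box. *)
Lemma open_measurable_rV n (U : set 'rV[R]_n) : open U -> measurable U.
Proof.
move=> oU.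
pose B (q : 'rV[rat]_n * rat) :=
  [set y : 'rV[R]_n | forall i, `|y 0 i - ratr (q.1 0 i)| < ratr q.2].
have -> : U = \bigcup_(q in [set q | B q `<=` U]) B q.
  apply/seteqP; split => [x Ux|x [q /= qU /qU//]].
  have /nbhs_ballP[e /= e0 eU] : nbhs x U by exact: open_nbhs_nbhs.
  have [r] : exists r, ratr r \in `]0, (e / 2) : R[.
    by apply: rat_in_itvoo; rewrite divr_gt0.
  rewrite in_itv/= => /andP[r0 re].
  have /choice[q qx] (i : 'I_n) : exists q : rat, `|x 0 i - ratr q| < ratr r.
    have [q] := @rat_in_itvoo R (x 0 i - ratr r) (x 0 i + ratr r)
      ltac:(by rewrite -subr_gt0; lra).
    by rewrite in_itv/= => qi; exists q; rewrite ltr_distl; lra.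
  exists (\row_i q i, r); last by move=> i /=; rewrite mxE.
  move=> y By; apply: eU; split=> // i j; rewrite ord1.
  have /andP[y1 y2] : ratr (q j) - ratr r < y 0 j < ratr (q j) + ratr r.
    by rewrite -ltr_distl; have := By j; rewrite /= mxE.
  have /andP[x1 x2] : ratr (q j) - ratr r < x 0 j < ratr (q j) + ratr r.
    by rewrite -ltr_distl.
  by rewrite /ball/= ltr_distl; apply/andP; split; lra.
rewrite bigcup_mkcond; apply: countable_bigcupT_measurable.
  exact: countableP.
move=> q; case: ifPn => // _.
rewrite (_ : B q = \bigcap_(i in [set: 'I_n])
    ((fun y : 'rV[R]_n => y 0 i) @^-1` [set t |
      `|t - ratr (q.1 0 i)| < ratr q.2])).
  apply: fin_bigcap_measurable => // i _.
  rewrite -[X in measurable X]setTI; apply: measurable_coor => //.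
  rewrite (_ : mkset _ = ball (ratr (q.1 0 i) : R) (ratr q.2)).
    by apply: open_measurable; exact: ball_open.
  by apply/funext => t; rewrite /ball/= distrC.
by apply/seteqP; split => y Bq i => [_|]; [exact: Bq|exact: (Bq i I)].
Qed.

End EuclideanNorm.

(** * Distance to a nonempty set *)

Section DistTo.
Context {R : realType} (n : nat) (K : set 'rV[R]_n).
Implicit Types x y : 'rV[R]_n.

Let has_lb x : has_lbound [set enorm (x - y) | y in K].
Proof. by exists 0 => _ [y _ <-]; exact: enorm_ge0. Qed.

Lemma dist_to_le x y : K y -> dist_to K x <= enorm (x - y).
Proof. by move=> Ky; apply: ge_inf => //; exists y. Qed.

Hypothesis K0 : K !=set0.

Lemma dist_to_ge0 x : 0 <= dist_to K x.
Proof.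
case: K0 => y Ky; apply: lb_le_inf; first by exists (enorm (x - y)), y.
by move=> _ [z _ <-]; exact: enorm_ge0.
Qed.

Lemma dist_to_lt x r : dist_to K x < r -> exists2 y, K y & enorm (x - y) < r.
Proof.
move=> xr; apply: contrapT => /forall2NP h.
suff : r <= dist_to K x by rewrite leNgt xr.
case: K0 => y Ky; apply: lb_le_inf; first by exists (enorm (x - y)), y.
by move=> _ [z Kz <-]; rewrite leNgt; apply/negP; case: (h z).
Qed.

Lemma dist_to_lip x y : dist_to K x <= enorm (x - y) + dist_to K y.
Proof.
apply/ler_addgt0Pl => e e0.
have [z Kz yz] : exists2 z, K z & enorm (y - z) < dist_to K y + e.
  by apply: dist_to_lt; rewrite ltrDl.
apply: le_trans (dist_to_le x Kz) _; apply: le_trans (enorm_triangle y _ _) _.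
by rewrite addrCA lerD2l addrC ltW.
Qed.

Lemma open_dist_to_lt r : open [set x | dist_to K x < r].
Proof.
rewrite openE => x /= xr; rewrite /interior.
apply: filterS (nbhs_eball x (_ : 0 < r - dist_to K x));
  last by rewrite subr_gt0.
move=> y; rewrite /eball/= => yx; apply: le_lt_trans (dist_to_lip y x) _.
by rewrite -ltrBrDr.
Qed.

Lemma measurable_dist_to D : measurable_fun D (dist_to K).
Proof.
apply: measurable_funTS; apply: (measurability _ (RGenInftyO.measurableE R)).
move=> _ [_ [r ->] <-]; rewrite setTI; apply: open_measurable_rV.
rewrite (_ : _ @^-1` _ = [set x | dist_to K x < r]);
  first exact: open_dist_to_lt.
by apply/seteqP; split => x /=; rewrite in_itv.
Qed.

Lemma dist_to_gt0 x : closed K -> ~ K x -> 0 < dist_to K x.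
Proof.
move=> cK nKx; rewrite lt_neqAle dist_to_ge0 andbT; apply/eqP => d0.
have [|r r0 rK] := @open_eballP _ _ (~` K) x _ nKx; first exact: closed_openC.
have [|y Ky xy] := @dist_to_lt x r; first by rewrite -d0.
by apply: (rK y) => //; rewrite /eball/= enormB.
Qed.

Lemma dist_to_eq0 x : K x -> dist_to K x = 0.
Proof.
move=> Kx; apply/eqP; rewrite eq_le dist_to_ge0 andbT.
by rewrite (le_trans (dist_to_le x Kx))// subrr enorm0.
Qed.

End DistTo.

(** * Lebesgue measure of Euclidean balls *)

Section BallMeasure.
Context {R : realType} (n : nat).
Implicit Types z : 'rV[R]_n.

Lemma measurable_eball z r : measurable (eball z r).
Proof. by apply: open_measurable_rV; exact: open_eball. Qed.

Lemma measurable_box (A : 'I_n -> set R) : (forall i, measurable (A i)) ->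
  measurable [set x : 'rV[R]_n | forall i, A i (x 0 i)].
Proof.
move=> mA; rewrite (_ : mkset _ = \bigcap_(i in [set: 'I_n])
    ((fun y : 'rV[R]_n => y 0 i) @^-1` A i)).
  apply: fin_bigcap_measurable => // i _.
  by rewrite -[X in measurable X]setTI; exact: measurable_coor.
by apply/seteqP; split => y Bq i => [_|]; [exact: Bq|exact: (Bq i I)].
Qed.

Lemma lebesgue_rV_eball_le z r : 0 <= r ->
  (lebesgue_rV n (eball z r) <= ((2 * r) ^+ n)%:E)%E.
Proof.
move=> r0; pose A i := `[z 0 i - r, z 0 i + r]%classic.
have mA i : measurable (A i) by exact: measurable_itv.
apply: (@le_trans _ _ (lebesgue_rV n [set x | forall i, A i (x 0 i)])).
  apply: le_measure; rewrite ?inE;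
    [exact: measurable_eball|exact: measurable_box|].
  move=> x zx i; rewrite /A/= in_itv/= -ler_distl.
  by have := coord_le_enorm (x - z) i; rewrite !mxE => /le_trans ->//;
    exact/ltW.
rewrite lebesgue_rV_box//.
rewrite (eq_bigr (fun=> (2 * r)%:E)); last first.
  move=> i _; rewrite /A lebesgue_measure_itv/= lte_fin; case: ifPn => h.
    by rewrite -EFinD; congr EFin; ring.
  by rewrite (_ : r = 0) ?mulr0//; move: h; lra.
by rewrite prodEFin prodr_const card_ord.
Qed.

Lemma lebesgue_rV_eball_ge z r : 0 < r ->
  (((r / n.+1%:R) ^+ n)%:E <= lebesgue_rV n (eball z r))%E.
Proof.
(* The cube of side [e] with corner [z] lies in the ball because [n * e < r]; the divisor [n.+1]
   makes this strict and covers [n = 0]. *)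
move=> r0; set e := r / n.+1%:R.
have e0 : 0 < e by rewrite divr_gt0.
pose A i := `[z 0 i, z 0 i + e]%classic.
have mA i : measurable (A i) by exact: measurable_itv.
apply: (@le_trans _ _ (lebesgue_rV n [set x | forall i, A i (x 0 i)])).
  rewrite lebesgue_rV_box//.
  rewrite (eq_bigr (fun=> e%:E)); last first.
    move=> i _; rewrite /A lebesgue_measure_itv/= lte_fin ltrDl e0.
    by rewrite -EFinD; congr EFin; ring.
  by rewrite prodEFin prodr_const card_ord.
apply: le_measure; rewrite ?inE;
  [exact: measurable_box|exact: measurable_eball|].
move=> x /= zx; rewrite /eball/=.
apply: (@le_lt_trans _ _ (n%:R * e)).
  apply: enorm_le_coord; first exact: ltW.
  move=> i; rewrite !mxE; have := zx i; rewrite /A/= in_itv/=.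
  by move=> /andP[h1 h2]; rewrite ger0_norm; lra.
by rewrite -[ltRHS](divfK (_ : n.+1%:R != 0))// mulrC -/e ltr_pM2l// ltr_nat.
Qed.

Lemma bounded_lebesgue_rV_lty (D : set 'rV[R]_n) : bounded_set D ->
  measurable D -> (lebesgue_rV n D < +oo)%E.
Proof.
move=> [M [_ DM]] mD.
apply: (@le_lt_trans _ _ (lebesgue_rV n (eball 0 (n%:R * (`|M| + 1) + 1)))).
  apply: le_measure; rewrite ?inE//; first exact: measurable_eball.
  move=> x Dx; rewrite /eball/= subr0.
  apply: le_lt_trans (enorm_le_norm x) _.
  rewrite (@le_lt_trans _ _ (n%:R * (`|M| + 1)))// ?ltrDl// ler_wpM2l//.
  by apply: DM => //; have := ler_norm M; lra.
apply: le_lt_trans (lebesgue_rV_eball_le _ _) _; last exact: ltry.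
by rewrite addr_ge0// mulr_ge0// addr_ge0.
Qed.

End BallMeasure.

(** * Geometry of the domain and of K *)

Section Compactness.
Context {R : realType} (n : nat).

(** Near-covering compactness against the right neighbourhoods of 0. It turns the constants of the
    local charts, of the boundary and of [K], into a single one. *)
Lemma compact_uniform (A : set 'rV[R]_n) (P : R -> 'rV[R]_n -> Prop) :
  compact A ->
  (forall x, A x -> exists2 r, 0 < r &
     forall y e, eball x r y -> 0 < e <= r -> P e y) ->
  exists2 e, 0 < e & forall y, A y -> P e y.
Proof.
move=> /compact_near_coveringP cA locP.
have nP : \forall e \near (0 : R)^'+, A `<=` P e.
  apply: cA => x /locP[r r0 rP].
  exists (eball x r, [set e | 0 < e <= r]) => /=.
    split; first exact: nbhs_eball.
    by near=> e; apply/andP; split; near: e;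
      [exact: nbhs_right_gt|exact: nbhs_right_le].
  by move=> [y e] /= [xy er]; exact: rP.
have [e [e0 eP]] := filter_ex (filterI (nbhs_right_gt (0 : R)) nP).
by exists e.
Unshelve. all: by end_near. Qed.

End Compactness.

(** * Measure density of a Lipschitz domain *)

Section MeasureDensity.
Context {R : realType}.

Lemma enorm_lsubmx m n (x : 'rV[R]_(m + n)) : enorm (lsubmx x) <= enorm x.
Proof.
rewrite -(@ler_pXn2r _ 2) ?nnegrE ?enorm_ge0// !enorm_sqr big_split_ord/=.
rewrite -[leLHS]addr0 lerD//.
  by rewrite le_eqVlt; apply/orP; left; apply/eqP/eq_bigr => i _; rewrite mxE.
by rewrite sumr_ge0// => i _; exact: sqr_ge0.
Qed.

Lemma enorm_rsubmx m n (x : 'rV[R]_(m + n)) : enorm (rsubmx x) <= enorm x.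
Proof.
rewrite -(@ler_pXn2r _ 2) ?nnegrE ?enorm_ge0// !enorm_sqr big_split_ord/=.
rewrite -[leLHS]add0r lerD//.
  by rewrite sumr_ge0// => i _; exact: sqr_ge0.
by rewrite le_eqVlt; apply/orP; left; apply/eqP/eq_bigr => i _; rewrite mxE.
Qed.

Variables (d : nat) (Omega : set 'rV[R]_d).

(* The inner balls are found by moving up from the graph in the direction of
   the last rotated coordinate. *)
Lemma lipschitz_boundary_corkscrew x : lipschitz_boundary Omega ->
  (closure Omega `\` interior Omega) x ->
  exists2 c, 0 < c & forall y t, Omega y -> eball x c y -> 0 < t <= c ->
    exists z, eball z (c * t) `<=` Omega `&` eball y t.
Proof.
move=> lO /lO[r [L [P [phi [r0 [PPT PTP] lphi OP]]]]].
pose M := Num.max L 0.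
have M0 : 0 <= M by rewrite le_max lexx orbT.
have LM : L <= M by rewrite le_max lexx.
(* With this [b] a ball of radius [b * t] about the point at height [t / 2] above [y] stays over the
   graph: the graph rises by at most [M * b * t], the last coordinate drops by less than [b * t],
   and these add up to [t / 2]. *)
pose b := (2 * (M + 1))^-1.
have b0 : 0 < b by rewrite invr_gt0 mulr_gt0// ltr_wpDl.
have bM : b * M + b = 2^-1.
  by rewrite /b; field; apply: lt0r_neq0; rewrite ltr_wpDl.
(* The bound [r / 4] keeps all points involved in the ball where the graph describes [Omega]. *)
pose c := Num.min b (r / 4).
have c0 : 0 < c by rewrite lt_min b0 divr_gt0.
have cb : c <= b by rewrite ge_min lexx.
have cr : c <= r / 4 by rewrite ge_min lexx orbT.
exists c => // y t Oy xy /andP[t0 tc].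
have ct : c * t <= b * t by rewrite ler_wpM2r// ltW.
(* The unit vector that the rotation takes to the last coordinate direction. *)
pose e : 'rV[R]_d := row_mx 0 (const_mx 1) *m P^T.
have eP : e *m P = row_mx 0 (const_mx 1) by rewrite -mulmxA PTP mulmx1.
have e1 : enorm e = 1.
  rewrite -(enorm_orthogonal e PPT) eP /enorm big_split_ord/= big1 ?add0r.
    by rewrite big_ord1 row_mxEr mxE expr1n sqrtr1.
  by move=> i _; rewrite row_mxEl mxE expr0n.
have t2 : 0 < t / 2 by rewrite divr_gt0.
exists (y + (t / 2) *: e) => w; rewrite /eball/=.
set v := w - _ => vt.
have wE : w = y + (t / 2) *: e + v by rewrite /v addrC subrK.
have {}vt : enorm v < b * t by exact: lt_le_trans vt ct.
have bt : b * t <= t / 2.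
  by rewrite mulrC ler_pM2l// -bM lerDr mulr_ge0// ltW.
have wy : enorm (w - y) < t.
  rewrite wE addrC -addrA addKr; apply: le_lt_trans (enormD _ _) _.
  by rewrite enormZ e1 mulr1 ger0_norm ?ltW//; lra.
have tr : t <= r / 4 by exact: le_trans cr.
split; last by [].
suff : (Omega `&` eball x r) w by case.
have yr : (Omega `&` eball x r) y.
  by split=> //; move: xy; rewrite /eball/=; lra.
rewrite OP; split; last first.
  apply: le_lt_trans (enorm_triangle y _ _) _.
  by move: xy; rewrite /eball/=; lra.
move: yr; rewrite OP => -[/= yphi _].
have vP : enorm (v *m P) < b * t by rewrite enorm_orthogonal.
pose q : 'rV[R]_(d.-1 + 1) := row_mx 0 (const_mx 1).
have wP : w *m P = y *m P + (t / 2) *: q + v *m P.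
  by rewrite wE !mulmxDl -scalemxAl eP.
have qR i : q 0 (rshift d.-1 i) = 1 by rewrite row_mxEr mxE.
have qL i : q 0 (lshift 1 i) = 0 by rewrite row_mxEl mxE.
clearbody q.
have -> : rsubmx (w *m P) 0 0 =
    rsubmx (y *m P) 0 0 + t / 2 + rsubmx (v *m P) 0 0.
  by rewrite wP; move: (y *m P) (v *m P) => ? ?; rewrite !mxE qR mulr1.
have lE : lsubmx (w *m P) - lsubmx (y *m P) = lsubmx (v *m P).
  apply/rowP => i; rewrite wP; move: (y *m P) (v *m P) => ? ?.
  by rewrite !mxE qL; ring.
have rv : `|rsubmx (v *m P) 0 0| < b * t.
  apply: le_lt_trans vP; apply: le_trans (enorm_rsubmx _).
  exact: coord_le_enorm.
have lv : phi (lsubmx (w *m P)) - phi (lsubmx (y *m P)) <= M * (b * t).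
  apply: le_trans (ler_norm _) _; apply: le_trans (lphi _ _) _.
  apply: (@le_trans _ _ (M * enorm (lsubmx (w *m P) - lsubmx (y *m P)))).
    by rewrite ler_wpM2r ?enorm_ge0.
  rewrite lE ler_wpM2l//; apply: le_trans (enorm_lsubmx _) _; exact: ltW.
have : M * (b * t) + b * t = t / 2.
  by rewrite mulrA -mulrDl (mulrC M) bM mulrC.
by move: rv; rewrite ltr_norml => /andP[]; lra.
Qed.

(** The closure of [Omega] is compact, so local constants suffice: at interior points small balls
    lie in [Omega], at boundary points the graph provides the inner balls. *)
Lemma corkscrew : open Omega -> bounded_set Omega -> lipschitz_boundary Omega ->
  exists2 c, 0 < c & forall y t, Omega y -> 0 < t <= c ->
    exists z, eball z (c * t) `<=` Omega `&` eball y t.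
Proof.
move=> oO bO lO.
have bcO : bounded_set (closure Omega).
  case: bO => M [_ OM]; exists (M + 2); split; first exact: num_real.
  move=> r Mr x /(_ (ball x 1) (nbhsx_ballx _ _ ltr01))[y [Oy]].
  rewrite mx_norm_ball /ball_/= => xy; rewrite -(subrK y x).
  apply: le_trans (ler_normD _ _) _.
  have := OM (M + 1) _ y Oy; rewrite ltrDl ltr01 => /(_ isT)/=; lra.
have cO := bounded_closed_compact bcO (@closed_closure _ Omega).
(* [c] bounds both [t] and the relative radius of the inner ball, so [P] persists when [c]
   decreases. *)
pose P c y := Omega y -> forall t,
  0 < t <= c -> exists z, eball z (c * t) `<=` Omega `&` eball y t.
suff /(compact_uniform cO)[c c0 cP] : forall x, closure Omega x ->
    exists2 r, 0 < r & forall y e, eball x r y -> 0 < e <= r -> P e y.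
  exists c => // y t Oy; apply: cP => //; exact: subset_closure.
have shrink y t c c' z : 0 < t -> c' <= c ->
    eball z (c * t) `<=` Omega `&` eball y t ->
    eball z (c' * t) `<=` Omega `&` eball y t.
  move=> t0 cc'; apply: subset_trans; apply: eball_sub.
  by rewrite subrr enorm0 add0r ler_wpM2r// ltW.
move=> x cx; have [Ox|nOx] := pselect (Omega x).
  have [r r0 rO] := open_eballP oO Ox.
  exists (Num.min 1 (r / 2)); first by rewrite lt_min ltr01 divr_gt0.
  move=> y e; rewrite /eball/= lt_min => /andP[_ xy].
  rewrite le_min => /and3P[e0 e1 er] Oy t /andP[t0 te]; exists y.
  apply: (shrink _ _ 1) => //; rewrite mul1r => z yz; split=> //.
  apply: rO; apply: (@eball_sub _ _ x y r (r / 2)); first lra.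
  by move: yz; rewrite /eball/=; lra.
have [|c c0 cP] := @lipschitz_boundary_corkscrew x lO.
  by split=> // /interior_subset.
exists c => // y e xy /andP[e0 ec] Oy t /andP[t0 te].
have [|z zP] := cP y t Oy xy; first by rewrite t0 (le_trans te).
by exists z; exact: shrink zP.
Qed.

(** The inner ball of radius [c * t] alone has measure at least [(c * t / d.+1) ^ d]. The minimum
    [b] lets one constant both bound [t] and give the density. *)
Lemma measure_density : bounded_lipschitz_domain Omega ->
  exists2 c, 0 < c & forall y t, Omega y -> 0 < t <= c ->
    ((c * t ^+ d)%:E <= lebesgue_rV d (Omega `&` eball y t))%E.
Proof.
case=> _ oO _ bO lO; have [c c0 cP] := corkscrew oO bO lO.
pose b := Num.min c ((c / d.+1%:R) ^+ d).
exists b; first by rewrite lt_min c0 exprn_gt0// divr_gt0.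
move=> y t Oy /andP[t0]; rewrite le_min => /andP[tc _].
have [|z zP] := cP y t Oy; first by rewrite t0 tc.
apply: (@le_trans _ _ (lebesgue_rV d (eball z (c * t)))).
  apply: le_trans (lebesgue_rV_eball_ge z _); last exact: mulr_gt0.
  rewrite lee_fin mulrAC exprMn ler_wpM2r//.
    by rewrite exprn_ge0 ?ltW.
  by rewrite ge_min lexx orbT.
apply: le_measure => //; rewrite inE; first exact: measurable_eball.
by apply: measurableI; [exact: open_measurable_rV|exact: measurable_eball].
Qed.

End MeasureDensity.

(** * Lipschitz charts and the measure of neighbourhoods of K *)

Section LipschitzNorm.
Context {R : realType} (m n : nat).
Implicit Types (D : set 'rV[R]_m) (f : 'rV[R]_m -> 'rV[R]_n).
Local Open Scope ereal_scope.

Let sup1_ge0 D f x : D x -> 0 <= ereal_sup [set (enorm (f x))%:E | x in D].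
Proof.
move=> Dx; apply: le_trans (_ : (enorm (f x))%:E <= _).
  by rewrite lee_fin enorm_ge0.
by apply: ereal_sup_ubound; exists x.
Qed.

Let sup2_ge D f x y : D x -> D y -> (enorm (f x - f y) / enorm (x - y))%:E <=
  ereal_sup [set (enorm (f x - f y) / enorm (x - y))%:E | x in D & y in D].
Proof. by move=> Dx Dy; apply: ereal_sup_ubound; exists x => //; exists y. Qed.

Lemma c01norm_ge0 D f : D !=set0 -> 0 <= c01norm D f.
Proof.
move=> [x Dx]; apply: adde_ge0; first exact: (sup1_ge0 f Dx).
apply: le_trans (sup2_ge f Dx Dx).
by rewrite lee_fin divr_ge0 ?enorm_ge0.
Qed.

(** The supremum of the norms is nonnegative, so the supremum of the difference quotients is itself
    at most [C]. *)
Lemma c01norm_lip D f C x y : c01norm D f <= C%:E -> D x -> D y ->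
  (enorm (f x - f y) <= C * enorm (x - y))%R.
Proof.
move=> fC Dx Dy; have [->|xy] := eqVneq x y;
  first by rewrite !subrr !enorm0 mulr0.
have xy0 : (0 < enorm (x - y))%R.
  rewrite lt_def enorm_ge0 andbT; apply: contra_neq xy => /enorm_eq0/eqP.
  by rewrite subr_eq0 => /eqP.
rewrite -ler_pdivrMr// -lee_fin; apply: le_trans fC.
by apply: le_trans (sup2_ge f Dx Dy) _; rewrite leeDr// (sup1_ge0 f Dx).
Qed.

End LipschitzNorm.

Section Codimension.
Context {R : realType}.

Lemma truncn_eq_dist (a b : R) : 0 <= a -> 0 <= b ->
  Num.truncn a = Num.truncn b -> `|a - b| < 1.
Proof.
move=> /Num.Theory.truncn_itv/andP[a1 a2] /Num.Theory.truncn_itv/andP[b1 b2] ab.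
move: a1 a2; rewrite ab -!natr1 => a1 a2; move: b2; rewrite -natr1 => b2.
by rewrite ltr_norml; apply/andP; split; lra.
Qed.

(* A cube of side 2r is cut into cells of side h. *)
Lemma grid_cover n (T : eqType) (A : set T) (zeta : T -> 'rV[R]_n)
    (z : 'rV[R]_n) (r h : R) :
  0 <= r -> 0 < h -> A !=set0 ->
  (forall w, A w -> forall j, `|zeta w 0 j - z 0 j| <= r) ->
  exists s : seq T, [/\ (size s)%:R <= (2 * r / h + 1) ^+ n,
    (forall c, c \in s -> A c) &
    forall w, A w -> exists2 c, c \in s &
      forall j, `|zeta w 0 j - zeta c 0 j| <= h].
Proof.
move=> r0 h0 [w0 Aw0] Ar.
pose M := Num.truncn (2 * r / h).
(* Coordinates counted from the corner of the cube in units of [h]; their integer parts name the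
   cell of [w]. *)
pose a w j := (zeta w 0 j - z 0 j + r) / h.
have aI w j : A w -> 0 <= a w j <= 2 * r / h.
  move=> /Ar/(_ j); rewrite ler_norml => /andP[h1 h2].
  apply/andP; split; first by apply: divr_ge0; [lra|exact: ltW].
  by rewrite /a ler_pM2r ?invr_gt0//; lra.
pose cell w : {ffun 'I_n -> 'I_M.+1} := [ffun j => inord (Num.truncn (a w j))].
(* A representative for every cell; cells that miss [A] get [w0], which keeps all representatives in
   [A]. *)
have /choice[g gP] (f : {ffun 'I_n -> 'I_M.+1}) :
    exists w, A w /\ ((exists2 v, A v & cell v = f) -> cell w = f).
  have [[v Av vf]|nf] := pselect (exists2 v, A v & cell v = f).
    by exists v.
  by exists w0; split.
exists [seq g f | f <- enum {ffun 'I_n -> 'I_M.+1}]; split.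
- rewrite size_map -cardE card_ffun !card_ord natrX.
  apply: lerXn2r; rewrite ?nnegrE//.
    by rewrite addr_ge0// divr_ge0 ?mulr_ge0// ltW.
  rewrite -natr1 lerD2r.
  have rh : 0 <= 2 * r / h by rewrite divr_ge0 ?mulr_ge0// ltW.
  by have /andP[] := Num.Theory.truncn_itv rh.
- by move=> c /mapP[f _ ->]; case: (gP f).
move=> w Aw; exists (g (cell w)).
  by apply: map_f; rewrite mem_enum.
have [Ag /(_ (ex_intro2 _ _ w Aw erefl)) gw] := gP (cell w).
move=> j; have /andP[w1 w2] := aI w j Aw; have /andP[g1 g2] := aI _ j Ag.
have : `|a w j - a (g (cell w)) j| < 1.
  apply: truncn_eq_dist => //.
  have := congr1 (fun f : {ffun 'I_n -> 'I_M.+1} => val (f j)) gw.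
  by rewrite !ffunE/= !inordK ?ltnS ?Num.Theory.le_truncn.
rewrite /a -mulrBl normrM (gtr0_norm (_ : 0 < h^-1)) ?invr_gt0//.
rewrite ltr_pdivrMr// mul1r => /ltW; congr (`|_| <= _); ring.
Qed.

(** [S] flattens [K] to the slice where the first [k] coordinates vanish, so a grid in [d - k]
    dimensions suffices, and [T] carries it back. Both maps are [C]-Lipschitz, which costs only
    constants. *)
Lemma chart_cover d k (Omega K : set 'rV[R]_d) C x : 0 < C ->
  c01_chart k Omega K C x ->
  exists2 c, 0 < c & forall z r rho, eball x c z -> 0 < r <= rho -> rho <= c ->
    exists s : seq 'rV[R]_d, (size s)%:R <= (c^-1 * (rho / r)) ^+ (d - k) /\
      forall w, K w -> eball z rho w -> exists2 v, v \in s & enorm (w - v) < r.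
Proof.
move=> C0 [rad [T [S /=]]].
set m := (d - k)%N; set Q := @cylinder R k m; set B := eball x rad.
move=> [rad0 [[_ _ TB] TS ST] TSC SK _].
have [Q0 B0] : closure Q !=set0 /\ closure B !=set0.
  have Bx : B x by exact: eballxx.
  split; last by exists x; exact: subset_closure.
  by have [xi Qxi _] := TB _ Bx; exists xi; exact: subset_closure.
have CT : (c01norm (closure Q) T <= C%:E)%E.
  by apply: le_trans TSC; rewrite leeDl ?c01norm_ge0.
have CS : (c01norm (closure B) S <= C%:E)%E.
  by apply: le_trans TSC; rewrite leeDr ?c01norm_ge0.
(* A grid of half-side [2 * C * rho] and step [r / (C * m.+1)] has at most
   [(4 * C ^ 2 * m.+1 * rho / r + 1) ^ m] cells, and [1 <= rho / r]. *)
pose N := 4 * C ^+ 2 * m.+1%:R + 1.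
have N0 : 0 < N by rewrite ltr_wpDl// !mulr_ge0 ?exprn_ge0// ltW.
pose c := Num.min (rad / 2) N^-1.
have c0 : 0 < c by rewrite lt_min divr_gt0//= invr_gt0.
exists c => // z r rho xz /andP[r0 rrho] rhoc.
pose A := K `&` eball z rho.
have rho0 : 0 < rho by exact: lt_le_trans rrho.
have AP w : A w -> [/\ B w, Q (S w) & lsubmx (S w) = 0].
  move=> [Kw zw]; have Bw : B w.
    apply: (@eball_sub _ _ x z rad rho) => //.
    have : c <= rad / 2 by rewrite ge_min lexx.
    by move: xz; rewrite /eball/=; lra.
  by have [] : [set xi | Q xi /\ lsubmx xi = 0] (S w) by rewrite -SK; exists w.
have [A0|/set0P[w0 Aw0]] := eqVneq A set0.
  exists [::]; split; last by move=> w Kw zw; suff : A w by rewrite A0.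
  by rewrite exprn_ge0// mulr_ge0 ?invr_ge0 ?divr_ge0// ltW.
have Bc w : B w -> closure B w by exact: subset_closure.
have Qc xi : Q xi -> closure Q xi by exact: subset_closure.
(* Points of one cell are at most [m * h] apart, so their images under [T] are at most
   [r * m / m.+1] apart, which is less than [r]. *)
pose h := r / (C * m.+1%:R).
have h0 : 0 < h by rewrite divr_gt0 ?mulr_gt0.
have [||w Aw j|s [sN sA sP]] := @grid_cover m _ A (fun w => rsubmx (S w))
    (rsubmx (S w0)) (C * (2 * rho)) h _ h0.
- by rewrite !mulr_ge0// ltW.
- by exists w0.
- have [Bw Qw _] := AP w Aw; have [Bw0 Qw0 _] := AP w0 Aw0.
  have -> : rsubmx (S w) 0 j - rsubmx (S w0) 0 j = rsubmx (S w - S w0) 0 j.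
    by rewrite !mxE.
  apply: le_trans (coord_le_enorm _ _) _; apply: le_trans (enorm_rsubmx _) _.
  apply: le_trans (c01norm_lip CS (Bc _ Bw) (Bc _ Bw0)) _.
  rewrite ler_pM2l//; apply: le_trans (enorm_triangle z _ _) _.
  move: Aw Aw0 => [_ zw] [_]; rewrite /eball/= (enormB w0) => zw0.
  by move: zw; rewrite /eball/=; lra.
exists s; split.
  apply: le_trans sN _; apply: lerXn2r; rewrite ?nnegrE.
  - by rewrite addr_ge0// divr_ge0 ?ltW// !mulr_gt0.
  - by rewrite mulr_ge0 ?invr_ge0 ?divr_ge0// ltW.
  apply: (@le_trans _ _ (N * (rho / r))); last first.
    apply: ler_wpM2r; first by rewrite divr_ge0// ltW.
    by rewrite -[N]invrK lef_pV2 ?posrE ?invr_gt0// ge_min lexx orbT.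
  rewrite /N [leRHS]mulrDl mul1r; apply: lerD;
    last by rewrite ler_pdivlMr// mul1r.
  rewrite le_eqVlt; apply/orP; left; apply/eqP; rewrite /h.
  by field; rewrite !lt0r_neq0.
move=> w Kw zw; have Aw : A w by [].
have [v vs wv] := sP w Aw; exists v => //.
have [Bw Qw lw] := AP w Aw; have [Bv Qv lv] := AP v (sA v vs).
rewrite -(ST w) ?inE// -(ST v) ?inE//.
apply: le_lt_trans (c01norm_lip CT (Qc _ Qw) (Qc _ Qv)) _.
have : enorm (S w - S v) <= m%:R * h.
  (* The first [k] coordinates of both points vanish, so only the last [m] enter the norm. *)
  rewrite (_ : enorm _ = enorm (rsubmx (S w - S v))).
    apply: enorm_le_coord; first exact: ltW.
    by move=> j; have := wv j; rewrite !mxE.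
  rewrite /enorm big_split_ord/= big1 ?add0r => [|i _].
    by congr Num.sqrt; apply: eq_bigr => i _; rewrite [in RHS]mxE.
  have /rowP/(_ i) := lw; have /rowP/(_ i) := lv; rewrite !mxE => -> ->.
  by rewrite subrr expr0n.
rewrite -(ler_pM2l C0) => /le_lt_trans; apply.
rewrite /h (_ : C * (_ * _) = r * (m%:R / m.+1%:R)); last by field;
  rewrite !lt0r_neq0.
by rewrite -[ltRHS]mulr1 ltr_pM2l// ltr_pdivrMr// mul1r ltr_nat.
Qed.

(** The set is covered by balls of radius [2 * r] about an [r]-net of the nearby part of [K]; the
    net has at most a multiple of [(rho / r) ^ (d - k)] points, and each ball has measure at most a
    multiple of [r ^ d]. *)
Lemma codim_neighborhood d k (Omega K : set 'rV[R]_d) :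
  (k <= d)%N -> compact_c01_codim k Omega K ->
  exists C e : R, [/\ 0 < C, 0 < e & forall y r rho, 0 < r <= rho -> rho <= e ->
    (lebesgue_rV d (eball y rho `&` [set x | dist_to K x < r]%R)
      <= (C * r ^+ k * rho ^+ (d - k))%:E)%E].
Proof.
move=> kd [K0 cK [C C0 chart]]; set m := (d - k)%N.
pose P e z := forall r rho, 0 < r <= rho -> rho <= e ->
    exists s : seq 'rV[R]_d, (size s)%:R <= (e^-1 * (rho / r)) ^+ m /\
      forall w, K w -> eball z rho w -> exists2 v, v \in s & enorm (w - v) < r.
have [e e0 eP] : exists2 e, 0 < e & forall z, K z -> P e z.
  apply: compact_uniform => // x /chart/(chart_cover C0)[c c0 cP].
  exists c => // z e xz /andP[e0 ec] r rho rrho rhoe.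
  have [s [sN sP]] := cP z r rho xz rrho (le_trans rhoe ec).
  exists s; split => //; apply: le_trans sN _.
  have /andP[r0 _] := rrho; have rho0 : 0 < rho by case/andP: rrho;
    exact: lt_le_trans.
  have rr0 : 0 <= rho / r by rewrite divr_ge0// ltW.
  have [c0' e0'] : 0 <= c^-1 /\ 0 <= e^-1 by rewrite !invr_ge0 !ltW.
  apply: lerXn2r; rewrite ?nnegrE; [exact: mulr_ge0|exact: mulr_ge0|].
  by rewrite ler_wpM2r// lef_pV2.
exists ((e^-1 * 4) ^+ m * 4 ^+ d), (e / 4).
split; [by rewrite mulr_gt0 ?exprn_gt0 ?mulr_gt0 ?invr_gt0|
  by rewrite divr_gt0|].
move=> y r rho /andP[r0 rrho] rhoe.
have rho0 : 0 < rho by exact: lt_le_trans rrho.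
have mE : measurable (eball y rho `&` [set x | dist_to K x < r]).
  apply: measurableI; first exact: measurable_eball.
  by apply: open_measurable_rV; exact: open_dist_to_lt.
(* If [K] has no point within [2 * rho] of [y], the set is empty, since its points are within
   [r <= rho] of [K]. *)
have [[z [Kz yz]]|nz] := pselect (exists z, K z /\ enorm (z - y) < 2 * rho);
    last first.
  rewrite (_ : _ `&` _ = set0) ?measure0.
    by rewrite lee_fin !mulr_ge0 ?exprn_ge0 ?mulr_ge0 ?invr_ge0// ltW.
  apply/seteqP; split => // x [yx /(dist_to_lt K0)[z Kz xz]]; apply: nz.
  exists z; split => //; apply: le_lt_trans (enorm_triangle x _ _) _.
  by move: yx; rewrite /eball/= enormB; lra.
(* The points of [K] that matter are within [r + rho + 2 * rho <= 4 * rho] of [z]. *)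
have [||s [sN sP]] := eP z Kz r (4 * rho).
- by rewrite r0/=; lra.
- lra.
apply: (@le_trans _ _ (\sum_(v <- s) lebesgue_rV d (eball v (2 * r)))%E).
  apply: (@le_trans _ _
      (lebesgue_rV d (\big[setU/set0]_(v <- s) eball v (2 * r)))).
    apply: le_measure; rewrite ?inE//.
      by apply: bigsetU_measurable => v _; exact: measurable_eball.
    move=> x [yx /(dist_to_lt K0)[w Kw xw]].
    have [|v vs wv] := sP w Kw.
      apply: le_lt_trans (enorm_triangle x _ _) _.
      have := enorm_triangle y x z; move: yx.
      by rewrite /eball/= (enormB y z) (enormB w x); lra.
    rewrite -bigcup_seq/=; exists v => //; rewrite /eball/=.
    by apply: le_lt_trans (enorm_triangle w _ _) _; lra.
  elim: s {sN sP} => [|v s IH]; first by rewrite !big_nil measure0.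
  rewrite !big_cons; apply: le_trans (measureU2 _ _ _) _.
  - exact: measurable_eball.
  - by apply: bigsetU_measurable => ? _; exact: measurable_eball.
  - by rewrite leeD2l.
apply: (@le_trans _ _ (\sum_(v <- s) ((4 * r) ^+ d)%:E)%E).
  apply: lee_sum => v _; apply: le_trans (lebesgue_rV_eball_le _ _) _.
    by rewrite mulr_ge0// ltW.
  by rewrite lee_fin mulrA -natrM.
rewrite sumEFin lee_fin big_const_seq count_predT iter_addr_0.
rewrite -[leLHS]mulr_natl.
apply: (@le_trans _ _ ((e^-1 * (4 * rho / r)) ^+ m * (4 * r) ^+ d)).
  by rewrite ler_wpM2r// exprn_ge0// mulr_ge0// ltW.
have rd : r ^+ d = r ^+ k * r ^+ m by rewrite -exprD subnKC.
have rm : r ^+ m != 0 by rewrite expf_neq0// lt0r_neq0.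
rewrite le_eqVlt; apply/orP; left; apply/eqP.
have em : e ^+ m != 0 by rewrite expf_neq0// lt0r_neq0.
rewrite !exprMn rd !exprVn; field.
by rewrite rm em.
Qed.

End Codimension.

(** * The inner Gagliardo integral *)

Lemma measurable_integral_section {R : realType} d1 d2
    (T1 : measurableType d1) (T2 : measurableType d2)
    (m : {sigma_finite_measure set T2 -> \bar R}) (A : set T2)
    (f : T1 * T2 -> R) : measurable A ->
  measurable_fun setT f -> (forall z, 0 <= f z) ->
  measurable_fun setT (fun x => \int[m]_(y in A) (f (x, y))%:E)%E.
Proof.
move=> mA mf f0; pose g (z : T1 * T2) := (f z * \1_A z.2)%:E.
apply: (eq_measurable_fun (fubini_F m g)) => [x _|].
  rewrite /fubini_F [RHS]integral_mkcond.
  apply: eq_integral => y _; rewrite /g/= patchE indicE.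
  by case: ifPn => _; rewrite ?mulr1 ?mulr0.
apply: measurable_fun_fubini_tonelli_F => [|z].
  apply/measurable_EFinP; apply: measurable_funM => //.
  by apply: measurableT_comp; [exact: measurable_indic|exact: measurable_snd].
by rewrite lee_fin mulr_ge0 ?f0.
Qed.

Section GagliardoDensity.
Context {R : realType} (d : nat) (s p : R) (Omega : set 'rV[R]_d).
Local Notation mu := (@lebesgue_rV R d).

Definition gagliardo_kernel (u : 'rV[R]_d -> R) (x y : 'rV[R]_d) : R :=
  (`|u x - u y| `^ p) / (enorm (x - y) `^ (d%:R + s * p)).

Definition gagliardo_density (u : 'rV[R]_d -> R) (x : 'rV[R]_d) : \bar R :=
  (\int[mu]_(y in Omega) (gagliardo_kernel u x y)%:E)%E.

Lemma gagliardo_kernel_ge0 u x y : 0 <= gagliardo_kernel u x y.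
Proof. by rewrite divr_ge0 ?powR_ge0. Qed.

Lemma gagliardo_density_ge0 u x : (0 <= gagliardo_density u x)%E.
Proof. by apply: integral_ge0 => y _; rewrite lee_fin gagliardo_kernel_ge0. Qed.

Lemma measurable_enorm m : measurable_fun [set: 'rV[R]_m] (@enorm R m).
Proof.
rewrite (_ : @enorm R m = (fun a => a `^ 2^-1) \o (fun x => \sum_i x 0 i ^+ 2)).
  apply: (measurableT_comp (measurable_powR _)).
  apply: (@measurable_sum _ _ _ _ _ _ (fun i (x : 'rV[R]_m) => x 0 i ^+ 2))
    => i.
  by apply: measurable_funX; exact: measurable_coor.
apply/funext => x /=; rewrite powR12_sqrt// sumr_ge0// => i _.
exact: sqr_ge0.
Qed.

Lemma measurable_enormB :
  measurable_fun [set: 'rV[R]_d * 'rV[R]_d] (fun z => enorm (z.1 - z.2)).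
Proof.
apply: (measurableT_comp (@measurable_enorm d)).
apply: measurable_fun_rV => i.
apply: (eq_measurable_fun (fun z : 'rV[R]_d * 'rV[R]_d => z.1 0 i - z.2 0 i)).
  by move=> z _; rewrite !mxE.
apply: measurable_funB.
  exact: (measurableT_comp (measurable_coor i) measurable_fst).
exact: (measurableT_comp (measurable_coor i) measurable_snd).
Qed.

Variable u : 'rV[R]_d -> R.
Hypothesis mu : measurable_fun setT u.

Lemma measurable_gagliardo_kernel : measurable_fun
  [set: 'rV[R]_d * 'rV[R]_d] (fun z => gagliardo_kernel u z.1 z.2).
Proof.
have mu1 := measurableT_comp mu (@measurable_fst _ _ 'rV[R]_d 'rV[R]_d).
have mu2 := measurableT_comp mu (@measurable_snd _ _ 'rV[R]_d 'rV[R]_d).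
apply: measurable_funM.
  apply: (measurableT_comp (measurable_powR _)).
  by apply: measurableT_comp; [exact: normr_measurable|exact: measurable_funB].
under eq_fun do rewrite -powRN.
exact: (measurableT_comp (measurable_powR _) measurable_enormB).
Qed.

Lemma measurable_gagliardo_kernelr x : measurable_fun setT (gagliardo_kernel
  u x).
Proof.
apply: (measurableT_comp measurable_gagliardo_kernel (_ : measurable_fun _
  (fun y => (x, y)))).
exact: pair1_measurable.
Qed.

Hypothesis mO : measurable Omega.

Lemma measurable_gagliardo_density : measurable_fun setT (gagliardo_density u).
Proof.
apply: (@measurable_integral_section _ _ _ _ _ _ _ (fun z => gagliardo_kernel
  u z.1 z.2)) => //.
  exact: measurable_gagliardo_kernel.
by move=> z; exact: gagliardo_kernel_ge0.
Qed.

End GagliardoDensity.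

(** * Pointwise lower bounds for the inner integral *)

Section PointwiseBounds.
Context {R : realType} (d : nat) (s p : R) (Omega : set 'rV[R]_d).
Hypotheses (s0 : 0 < s) (p0 : 0 < p) (mO : measurable Omega).
Variable u : 'rV[R]_d -> R.
Hypothesis mu : measurable_fun setT u.
Local Notation leb := (@lebesgue_rV R d).
Local Notation sigma := (d%:R + s * p).
Local Notation gag := (gagliardo_density s p Omega u).
Implicit Types E : set 'rV[R]_d.

Lemma powR_sigma (t : R) : 0 < t -> t `^ sigma = t ^+ d * t `^ (s * p).
Proof.
move=> t0; rewrite -powR_mulrn ?ltW// -powRD//.
by apply/implyP => _; rewrite gt_eqF.
Qed.

Lemma measurable_norm_powR q D :
  measurable_fun D (fun x => (`|u x| `^ q)%:E).
Proof.
apply: measurable_funTS; apply/measurable_EFinP.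
apply: (measurableT_comp (measurable_powR _)).
by apply: measurableT_comp; [exact: normr_measurable|].
Qed.

Lemma measurable_norm_gt b : measurable [set y | b < `|u y|].
Proof.
have mn : measurable_fun setT (fun y => `|u y|).
  by apply: measurableT_comp => //; exact: normr_measurable.
have := mn measurableT `]b, +oo[%classic (measurable_itv _).
rewrite setTI; congr measurable.
by apply/seteqP; split => y; rewrite /= in_itv/= andbT.
Qed.

Lemma norm_chebyshev E q b : measurable E -> 0 <= b -> 0 <= q ->
  (forall y, E y -> b <= `|u y|) ->
  ((b `^ q)%:E * leb E <= \int[leb]_(y in E) (`|u y| `^ q)%:E)%E.
Proof.
move=> mE b0 q0 bu; rewrite -integral_cst//; apply: ge0_le_integral => //.
- by move=> y _; rewrite lee_fin powR_ge0.
- exact: measurable_norm_powR.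
- by move=> y Ey; rewrite lee_fin ge0_ler_powR ?nnegrE//; exact: bu.
Qed.

Lemma gagliardo_density_ge E x t b : measurable E -> E `<=` Omega ->
  E `<=` eball x t -> 0 < t -> 0 <= b ->
  (forall y, E y -> b <= `|u x - u y|) ->
  ((b `^ p)%:E * leb E <= (t `^ sigma)%:E * gag x)%E.
Proof.
move=> mE EO Et t0 b0 bu.
have sigma0 : 0 <= sigma by rewrite addr_ge0// mulr_ge0 ?ltW.
have mk D : measurable_fun D (fun y => (gagliardo_kernel s p u x y)%:E).
  by apply/measurable_funTS/measurable_EFinP;
    exact: measurable_gagliardo_kernelr.
have k0 y : (0 <= (gagliardo_kernel s p u x y)%:E)%E.
  by rewrite lee_fin gagliardo_kernel_ge0.
apply: (@le_trans _ _
    ((t `^ sigma)%:E * \int[leb]_(y in E) (gagliardo_kernel s p u x y)%:E)%E);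
    last first.
  by apply: lee_wpmul2l; [rewrite lee_fin powR_ge0|exact: ge0_subset_integral].
rewrite -ge0_integralZl_EFin//; last exact: powR_ge0.
rewrite -integral_cst//; apply: ge0_le_integral => //.
- by move=> y _; rewrite lee_fin powR_ge0.
- exact: measurable_funeM.
move=> y Ey; rewrite -EFinM lee_fin /gagliardo_kernel.
(* On the diagonal the kernel vanishes, but there [b] must be 0 as well. *)
have [xy|xy] := eqVneq x y.
  rewrite xy !subrr normr0 !powR0 ?gt_eqF// ?mul0r ?mulr0.
  have := bu _ Ey; rewrite xy subrr normr0 => b0'.
  by rewrite (_ : b = 0) ?powR0 ?gt_eqF//; apply/eqP; rewrite eq_le b0 b0'.
have xy0 : 0 < enorm (x - y).
  rewrite lt_def enorm_ge0 andbT; apply: contra_neq xy => /enorm_eq0/eqP.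
  by rewrite subr_eq0 => /eqP.
rewrite mulrCA -[leLHS]mulr1; apply: ler_pM; rewrite ?powR_ge0//.
  by apply: ge0_ler_powR; rewrite ?nnegrE; [exact: ltW|by []|by []|exact: bu].
rewrite ler_pdivlMr ?powR_gt0// mul1r; apply: ge0_ler_powR => //.
- by rewrite nnegrE ltW.
- by rewrite nnegrE ltW.
- by have := Et _ Ey; rewrite /eball/= enormB => /ltW.
Qed.

(** [E] is split at the level [|u x| / 2]: where [|u|] is below it the Gagliardo density controls
    the measure, elsewhere Chebyshev's inequality does. *)
Lemma half_norm_split E x t : measurable E -> E `<=` Omega ->
  E `<=` eball x t -> 0 < t ->
  (((`|u x| / 2) `^ p)%:E * leb E <=
    (t `^ sigma)%:E * gag x + \int[leb]_(y in E) (`|u y| `^ p)%:E)%E.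
Proof.
move=> mE EO Et t0; set b := `|u x| / 2.
have b0 : 0 <= b by rewrite divr_ge0.
pose A := [set y | b < `|u y|].
have mA : measurable A by exact: measurable_norm_gt.
rewrite (@measureDI _ _ _ leb E A)// muleDr//; last first.
  by rewrite ge0_adde_def// inE measure_ge0.
apply: leeD.
  apply: gagliardo_density_ge => //.
  - exact: measurableD.
  - by move=> y [/EO].
  - by move=> y [/Et].
  move=> y [_ /negP]; rewrite -leNgt => uy.
  by have := lerB_dist (u x) (u y); move: uy; rewrite /b; lra.
apply: (@le_trans _ _ (\int[leb]_(y in E `&` A) (`|u y| `^ p)%:E)%E).
  apply: norm_chebyshev => //; [exact: measurableI|exact: ltW|].
  by move=> y [_ /ltW].
apply: ge0_subset_integral => //; first exact: measurableI.
exact: measurable_norm_powR.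
Qed.

(** By Chebyshev's inequality the points where [|u|] exceeds [|u x| / 2] use up at most half of the
    density bound; the other half is left for [gagliardo_density_ge]. The exponent [q] is free
    because the Sobolev exponent and [p] both occur. *)
Lemma ball_half_norm_split c q x t :
  0 <= q -> 0 < t -> 0 < `|u x| ->
  ((c * t ^+ d)%:E <= leb (Omega `&` eball x t))%E ->
  (\int[leb]_(y in Omega) (`|u y| `^ q)%:E <=
    ((`|u x| / 2) `^ q * (c / 2 * t ^+ d))%:E)%E ->
  ((c / 2 * (`|u x| / 2) `^ p)%:E <= (t `^ (s * p))%:E * gag x)%E.
Proof.
move=> q0 t0 ux dens; set b := `|u x| / 2 => uq.
have b0 : 0 < b by rewrite divr_gt0.
pose A := [set y | b < `|u y|].
have mA : measurable A by exact: measurable_norm_gt.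
set E := Omega `&` eball x t.
have mE : measurable E by apply: measurableI => //; exact: measurable_eball.
have bq : 0 < b `^ q by rewrite powR_gt0.
have EA : (leb (E `&` A) <= (c / 2 * t ^+ d)%:E)%E.
  rewrite -(@lee_pmul2l _ (b `^ q)%:E)// ?lte_fin//.
  rewrite -EFinM; apply: le_trans uq.
  apply: le_trans (_ : _ <= \int[leb]_(y in E `&` A) (`|u y| `^ q)%:E)%E _.
    apply: norm_chebyshev => //; [exact: measurableI|exact: ltW|].
    by move=> y [_ /ltW].
  apply: ge0_subset_integral => //; first exact: measurableI.
  - exact: measurable_norm_powR.
  - by move=> y [[]].
have EDA : ((c / 2 * t ^+ d)%:E <= leb (E `\` A))%E.
  move: dens; rewrite -/E (@measureDI _ _ _ leb E A)//.
  rewrite {1}(splitr c) mulrDl EFinD => h.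
  have := le_trans h (leeD2l _ EA).
  by rewrite leeD2rE.
have : ((b `^ p)%:E * leb (E `\` A) <= (t `^ sigma)%:E * gag x)%E.
  apply: gagliardo_density_ge => //.
  - exact: measurableD.
  - by move=> y [[]].
  - by move=> y [[]].
  - exact: ltW.
  move=> y [_ /negP]; rewrite -leNgt => uy.
  by have := lerB_dist (u x) (u y); move: uy; rewrite /b; lra.
have td : 0 < t ^+ d by rewrite exprn_gt0.
move/(le_trans (lee_wpmul2l _ EDA)); rewrite lee_fin powR_ge0 => /(_ isT).
rewrite -EFinM powR_sigma// (EFinM (t ^+ d)) -muleA => h.
rewrite -(@lee_pmul2l _ (t ^+ d)%:E) ?lte_fin// -EFinM; move: h.
by rewrite (_ : t ^+ d * (c / 2 * b `^ p) = b `^ p * (c / 2 * t ^+ d));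
  last ring.
Qed.

End PointwiseBounds.

(** * Fractional Sobolev inequality *)

Section Sobolev.
Context {R : realType} (d : nat) (s p c : R) (Omega : set 'rV[R]_d).
Hypotheses (s0 : 0 < s) (p0 : 0 < p) (c0 : 0 < c) (spd : s * p < d%:R).
Hypotheses (mO : measurable Omega).
Local Notation leb := (@lebesgue_rV R d).
Hypothesis density : forall y t, Omega y -> 0 < t <= c ->
  ((c * t ^+ d)%:E <= leb (Omega `&` eball y t))%E.
Local Notation q := (sobolev_exponent d s p).
Local Notation theta := (s * p / d%:R).

Let d0 : 0 < d%:R :> R.
Proof. by apply: le_lt_trans spd; rewrite mulr_ge0 ?ltW. Qed.

Lemma sobolev_exponent_gt0 : 0 < q.
Proof. by rewrite /sobolev_exponent divr_gt0 ?subr_gt0// mulr_gt0. Qed.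

Lemma sobolev_exponentM : q * theta = q - p.
Proof.
rewrite /sobolev_exponent; field.
by rewrite subr_eq0 !gt_eqF.
Qed.

Lemma sobolev_exponent_div : q / p * (1 - theta) = 1.
Proof.
rewrite /sobolev_exponent; field.
by rewrite subr_eq0 !gt_eqF.
Qed.

Variable u : 'rV[R]_d -> R.
Hypothesis mu : measurable_fun setT u.
Local Notation gag := (gagliardo_density s p Omega u).

(** Three regimes: the radius dictated by [A] is at most [c]; it exceeds [c], but [V] is small
    enough for the radius [c]; or [|u x|] is itself bounded in terms of [V], which is the lower
    order term. *)
Lemma sobolev_pointwise (A V : R) x : 0 < A -> 0 <= V -> Omega x ->
  (\int[leb]_(y in Omega) (`|u y| `^ q)%:E <= A%:E)%E ->
  (\int[leb]_(y in Omega) (`|u y| `^ p)%:E <= V%:E)%E ->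
  (((`|u x| / 2) `^ q)%:E <=
    (2 / c * (2 / c * A) `^ theta)%:E * gag x +
    ((2 / c / c ^+ d * V) `^ (q / p))%:E)%E.
Proof.
move=> A0 V0 Ox uA uV; set b := `|u x| / 2; set D := 2 / c.
have q0 := sobolev_exponent_gt0.
have th0 : 0 < theta by rewrite divr_gt0// mulr_gt0.
have D0 : 0 < D by rewrite divr_gt0.
have cd0 : 0 < c ^+ d by rewrite exprn_gt0.
have := normr_ge0 (u x); rewrite le_eqVlt => /orP[/eqP ux0|ux].
  rewrite /b -ux0 mul0r powR0 ?gt_eqF// adde_ge0 ?lee_fin ?powR_ge0//.
  by rewrite mule_ge0 ?gagliardo_density_ge0// lee_fin mulr_ge0 ?powR_ge0// ltW.
have b0 : 0 < b by rewrite divr_gt0.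
have bq : 0 < b `^ q by rewrite powR_gt0.
(* [b ^ q] is [b ^ (q * theta) * b ^ p], and [b ^ (q * theta) * t ^ (s * p)] is the power [theta] of
   [b ^ q * t ^ d]. *)
have key t : 0 < t -> b `^ q * t ^+ d <= D * A ->
    ((c / 2 * b `^ p)%:E <= (t `^ (s * p))%:E * gag x)%E ->
    ((b `^ q)%:E <= (D * (D * A) `^ theta)%:E * gag x)%E.
  move=> t0 btA bg.
  have bE : b `^ q = D * b `^ (q * theta) * (c / 2 * b `^ p).
    rewrite sobolev_exponentM powRB; last by rewrite (gt_eqF b0) implybT.
    by rewrite /D; field; rewrite !lt0r_neq0 ?powR_gt0.
  have Db0 : (0 <= (D * b `^ (q * theta))%:E)%E.
    by rewrite lee_fin mulr_ge0 ?powR_ge0// ltW.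
  rewrite bE EFinM; apply: le_trans (lee_wpmul2l Db0 bg) _.
  rewrite muleA -EFinM; apply: lee_wpmul2r; first exact: gagliardo_density_ge0.
  rewrite lee_fin -[leLHS]mulrA ler_pM2l//.
  have -> : b `^ (q * theta) * t `^ (s * p) = (b `^ q * t ^+ d) `^ theta.
    have spE : s * p = d%:R * theta by field; rewrite gt_eqF.
    rewrite [X in _ * t `^ X]spE powRM ?powR_ge0 ?exprn_ge0 ?(ltW t0)//.
    by rewrite -powR_mulrn ?(ltW t0)// -(powRrM b) -(powRrM t).
  apply: ge0_ler_powR => //; first exact: ltW.
  - by rewrite nnegrE mulr_ge0 ?exprn_ge0// ltW.
  - by rewrite nnegrE mulr_ge0// ltW.
have add0 (y z : \bar R) : (0 <= z -> y <= y + z)%E by move=> z0; rewrite leeDl.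
(* For this radius the bound required in Chebyshev's inequality with exponent [q] is exactly [A]. *)
pose t := (D * A / b `^ q) `^ d%:R^-1.
have tA0 : 0 < D * A / b `^ q by rewrite divr_gt0// mulr_gt0.
have t0 : 0 < t by rewrite powR_gt0.
have td : t ^+ d = D * A / b `^ q.
  by rewrite -powR_mulrn ?ltW// -powRrM mulVf ?gt_eqF// powRr1// ltW.
have [tc|ct] := leP t c.
  apply: le_trans (add0 _ _ _); last by rewrite lee_fin powR_ge0.
  apply: (key t) => //; first by rewrite td mulrC divfK ?gt_eqF.
  apply: (ball_half_norm_split (q := q) s0 p0 mO mu (ltW q0) t0 ux).
    by apply: density; rewrite ?t0.
  apply: le_trans uA _; rewrite lee_fin td -/b le_eqVlt; apply/orP; left.
  by apply/eqP; rewrite /D; field; rewrite !gt_eqF.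
(* The density holds only up to radius [c], so for [c < t] the radius is [c], and Chebyshev's
   inequality is used with [p] and [V]. *)
have [bV|bV] := leP (D / c ^+ d * V) (b `^ p).
  apply: le_trans (add0 _ _ _); last by rewrite lee_fin powR_ge0.
  apply: (key c) => //.
    rewrite mulrC -ler_pdivlMr// -td.
    by apply: lerXn2r; rewrite ?nnegrE; exact: ltW.
  apply: (ball_half_norm_split (q := p) s0 p0 mO mu (ltW p0) c0 ux).
    by apply: density; rewrite ?c0/=.
  apply: le_trans uV _; rewrite lee_fin -/b.
  move: bV; rewrite -(@ler_pM2r _ (c / 2 * c ^+ d)); last first.
    by rewrite mulr_gt0 ?divr_gt0.
  apply: le_trans; rewrite le_eqVlt; apply/orP; left; apply/eqP.
  by rewrite /D; field; rewrite !gt_eqF.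
rewrite -[X in (X <= _)%E]add0e; apply: leeD.
  by rewrite mule_ge0 ?gagliardo_density_ge0// lee_fin mulr_ge0 ?powR_ge0// ltW.
rewrite lee_fin (_ : q = p * (q / p));
  last by rewrite mulrCA divff ?mulr1 ?gt_eqF.
rewrite powRrM [X in _ <= _ `^ X](_ : _ = q / p); last first.
  by rewrite mulrCA divff ?mulr1 ?gt_eqF.
apply: ge0_ler_powR; rewrite ?nnegrE ?powR_ge0//.
- by rewrite divr_ge0// ltW.
- by rewrite mulr_ge0// ltW// divr_gt0.
- exact: ltW.
Qed.

End Sobolev.

Section SobolevInequality.
Context {R : realType} (d : nat) (s p c : R) (Omega : set 'rV[R]_d).
Hypotheses (s0 : 0 < s) (p0 : 0 < p) (c0 : 0 < c) (spd : s * p < d%:R).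
Hypotheses (mO : measurable Omega).
Local Notation leb := (@lebesgue_rV R d).
Hypothesis density : forall y t, Omega y -> 0 < t <= c ->
  ((c * t ^+ d)%:E <= leb (Omega `&` eball y t))%E.
Hypothesis finO : (leb Omega < +oo)%E.
Local Notation q := (sobolev_exponent d s p).
Local Notation theta := (s * p / d%:R).

(** The integrated pointwise bound reads [A <= C1 * A ^ theta * M + C2 * Q] with [theta < 1], and is
    solved for [A]. The bound [N] makes [A] finite and does not enter [C]. *)
Lemma sobolev_bounded : exists2 C : R, 0 < C &
  forall (u : 'rV[R]_d -> R) (N M : R), measurable_fun setT u -> 0 <= N ->
    (forall x, Omega x -> `|u x| <= N) -> 0 < M ->
    (\int[leb]_(x in Omega) gagliardo_density s p Omega u x <= M%:E)%E ->
    (\int[leb]_(x in Omega) (`|u x| `^ p)%:E <= M%:E)%E ->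
    (\int[leb]_(x in Omega) (`|u x| `^ q)%:E <= (C * M `^ (q / p))%:E)%E.
Proof.
have q0 := sobolev_exponent_gt0 s0 p0 spd.
have d0 : 0 < d%:R :> R by apply: le_lt_trans spd; rewrite mulr_ge0 ?ltW.
have th0 : 0 < theta by rewrite divr_gt0// mulr_gt0.
set D := 2 / c; have D0 : 0 < D by rewrite divr_gt0.
have cd0 : 0 < c ^+ d by rewrite exprn_gt0.
have [m [m0 mE]] : exists m, 0 <= m /\ leb Omega = m%:E.
  exists (fine (leb Omega)); rewrite fine_ge0//; split => //.
  by rewrite fineK// ge0_fin_numE.
pose C1 := 2 `^ q * (D * D `^ theta).
pose C2 := 2 `^ q * ((D / c ^+ d) `^ (q / p) * m).
have C10 : 0 < C1 by rewrite mulr_gt0 ?powR_gt0// mulr_gt0 ?powR_gt0.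
have C20 : 0 <= C2 by rewrite !mulr_ge0 ?powR_ge0.
exists (1 + (C1 + C2) `^ (q / p)); first by rewrite ltr_pwDl// powR_ge0.
move=> u N M mu N0 uN M0 gM uM.
set I := (X in (X <= _)%E).
have I0 : (0 <= I)%E by apply: integral_ge0 => x _; rewrite lee_fin powR_ge0.
have Ioo : (I < +oo)%E.
  apply: (@le_lt_trans _ _ (\int[leb]_(x in Omega) (cst (N `^ q)%:E x))%E).
    apply: ge0_le_integral => //.
    - exact: measurable_norm_powR.
    - move=> x Ox; rewrite lee_fin; apply: ge0_ler_powR; rewrite ?nnegrE//.
        exact: ltW.
      exact: uN.
  by rewrite integral_cst// [X in (_ * X)%E]mE -EFinM ltry.
have [A IA] : exists A, I = A%:E by exists (fine I);
  rewrite fineK// ge0_fin_numE.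
have [A0|A0] := leP A 0.
  rewrite IA lee_fin (le_trans A0)// mulr_ge0 ?powR_ge0//.
  by rewrite addr_ge0// powR_ge0.
pose Q := M `^ (q / p).
have Q0 : 0 < Q by rewrite powR_gt0.
have AC : A <= C1 * A `^ theta * M + C2 * Q.
  have half x : ((`|u x| / 2) `^ q)%:E = ((2 `^ q)^-1%:E * (`|u x| `^ q)%:E)%E.
    by rewrite -EFinM powRM// -[in LHS](powR_inv1 (ltW _))//
      -powRrM mulN1r powRN mulrC.
  have : (\int[leb]_(x in Omega) ((`|u x| / 2) `^ q)%:E <=
      \int[leb]_(x in Omega)
        ((D * (D * A) `^ theta)%:E * gagliardo_density s p Omega u x +
        ((D / c ^+ d * M) `^ (q / p))%:E))%E.
    apply: ge0_le_integral => //.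
    - apply: measurable_funTS; under eq_fun do rewrite half.
      by apply: measurable_funeM; exact: measurable_norm_powR.
    - apply: emeasurable_funD => //; apply: measurable_funeM.
      by apply: measurable_funTS; exact: measurable_gagliardo_density.
    - move=> x Ox; apply: sobolev_pointwise => //; first exact: ltW.
      by rewrite -/I IA.
  under eq_integral do rewrite half.
  rewrite ge0_integralZl_EFin//; last exact: measurable_norm_powR.
  rewrite ge0_integralD//; last 3 first.
  - move=> x _; rewrite mule_ge0 ?gagliardo_density_ge0//.
    by rewrite lee_fin mulr_ge0 ?powR_ge0// ltW.
  - apply: measurable_funeM.
    by apply: measurable_funTS; exact: measurable_gagliardo_density.
  - by move=> x _; rewrite lee_fin powR_ge0.
  rewrite ge0_integralZl_EFin//; last 3 first.
  - by move=> x _; exact: gagliardo_density_ge0.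
  - by apply: measurable_funTS; exact: measurable_gagliardo_density.
  - by rewrite mulr_ge0 ?powR_ge0// ltW.
  rewrite integral_cst// [X in (_ + _ * X)%E]mE -/I IA => h.
  have : ((2 `^ q)^-1 * A <= D * (D * A) `^ theta * M + (D / c ^+ d * M) `^
    (q / p) * m).
    rewrite -lee_fin EFinM; apply: le_trans h _; rewrite EFinD !EFinM leeD2r//.
    apply: lee_wpmul2l gM; rewrite lee_fin.
    by rewrite mulr_ge0 ?powR_ge0// ltW.
  rewrite mulrC ler_pdivrMr ?powR_gt0// => /le_trans; apply.
  rewrite le_eqVlt; apply/orP; left; apply/eqP.
  rewrite /C1 /C2 /Q (powRM _ (ltW D0) (ltW A0)).
  rewrite (powRM _ (ltW (divr_gt0 D0 cd0)) (ltW M0)); ring.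
have [AQ|QA] := leP A Q.
  rewrite IA lee_fin -/Q (le_trans AQ)// ler_peMl// ?(ltW Q0)//.
  by rewrite lerDl powR_ge0.
have th1 : theta < 1 by rewrite ltr_pdivrMr// mul1r.
have qpth := sobolev_exponent_div s0 p0 spd.
have Ath : 0 < A `^ theta by rewrite powR_gt0.
(* [Q = Q ^ theta * M] because [q / p * (1 - theta) = 1]; as [Q < A], the lower order term merges
   with the main one. *)
have QAM : Q <= A `^ theta * M.
  have -> : Q = Q `^ theta * M.
    rewrite /Q -powRrM -[X in _ = _ * X]powRr1 ?(ltW M0)// -powRD; last first.
      by rewrite (gt_eqF M0) implybT.
    by congr (_ `^ _); rewrite -[X in _ + X]qpth mulrBr mulr1 addrC subrK.
  by rewrite ler_pM2r//; apply: ge0_ler_powR;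
    rewrite ?nnegrE ?(ltW th0) ?(ltW QA) ?(ltW A0) ?(ltW Q0).
have {}AC : A `^ (1 - theta) <= (C1 + C2) * M.
  rewrite powRB ?(gt_eqF A0) ?implybT// powRr1 ?(ltW A0)// ler_pdivrMr//.
  apply: le_trans AC _.
  have -> : (C1 + C2) * M * A `^ theta =
      C1 * A `^ theta * M + C2 * (A `^ theta * M) by ring.
  by rewrite lerD2l; exact: ler_wpM2l.
rewrite IA lee_fin mulrDl mul1r -/Q.
apply: le_trans (_ : A <= (C1 + C2) `^ (q / p) * Q) _; last first.
  by rewrite lerDr ltW.
have CC0 : 0 <= C1 + C2 by rewrite addr_ge0// ltW.
rewrite -powRM ?(ltW M0)//.
have -> : A = (A `^ (1 - theta)) `^ (q / p).
  by rewrite -powRrM [X in A `^ X]mulrC qpth powRr1 ?(ltW A0).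
apply: ge0_ler_powR => //; rewrite ?nnegrE ?powR_ge0//.
- by rewrite divr_ge0// ltW.
- by rewrite mulr_ge0// ltW.
Qed.


End SobolevInequality.

(** * Fractional Hardy inequality *)

Lemma tonelli_restrict {R : realType} d1 d2 (T1 : measurableType d1)
    (T2 : measurableType d2) (m1 : {sigma_finite_measure set T1 -> \bar R})
    (m2 : {sigma_finite_measure set T2 -> \bar R}) (A : set T1) (B : set T2)
    (f : T1 * T2 -> R) : measurable A -> measurable B ->
  measurable_fun setT f -> (forall z, 0 <= f z) ->
  (\int[m1]_(x in A) \int[m2]_(y in B) (f (x, y))%:E =
   \int[m2]_(y in B) \int[m1]_(x in A) (f (x, y))%:E)%E.
Proof.
move=> mA mB mf f0.
pose g (z : T1 * T2) := (f z * (\1_A z.1 * \1_B z.2))%:E.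
have mg : measurable_fun setT g.
  apply/measurable_EFinP; apply: measurable_funM => //; apply: measurable_funM.
    by apply: measurableT_comp; [exact: measurable_indic|exact: measurable_fst].
  by apply: measurableT_comp; [exact: measurable_indic|exact: measurable_snd].
have g0 z : (0 <= g z)%E by rewrite lee_fin !mulr_ge0 ?f0.
transitivity (\int[m1]_x \int[m2]_y g (x, y))%E.
  rewrite integral_mkcond; apply: eq_integral => x _; rewrite patchE.
  case: ifPn => xA.
    rewrite integral_mkcond; apply: eq_integral => y _.
    by rewrite patchE /g/= !indicE xA mul1r; case: ifPn; rewrite ?mulr1 ?mulr0.
  rewrite integral0_eq// => y _.
  by rewrite /g/= !indicE (negbTE xA) mul0r mulr0.
rewrite (fubini_tonelli g mg g0).
rewrite [RHS]integral_mkcond; apply: eq_integral => y _; rewrite patchE.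
case: ifPn => yB.
  rewrite [RHS]integral_mkcond; apply: eq_integral => x _.
  by rewrite patchE /g/= !indicE yB mulr1; case: ifPn; rewrite ?mulr1 ?mulr0.
rewrite integral0_eq// => x _.
by rewrite /g/= !indicE (negbTE yB) !mulr0.
Qed.

Section Hardy.
Context {R : realType} (d k : nat) (s p c Ca e : R) (Omega K : set 'rV[R]_d).
Hypotheses (s0 : 0 < s) (p0 : 0 < p) (c0 : 0 < c) (Ca0 : 0 < Ca).
Hypothesis (kd : (k <= d)%N).
Hypotheses (mO : measurable Omega) (K0 : K !=set0).
Local Notation leb := (@lebesgue_rV R d).
Local Notation delta := (dist_to K).
Local Notation sigma := (d%:R + s * p).
Hypothesis density : forall y t, Omega y -> 0 < t <= c ->
  ((c * t ^+ d)%:E <= leb (Omega `&` eball y t))%E.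
Hypothesis codim : forall y r rho, 0 < r <= rho -> rho <= e ->
  (leb (eball y rho `&` [set x | delta x < r]%R)
    <= (Ca * r ^+ k * rho ^+ (d - k))%:E)%E.

Variables (eta L : R).
Hypotheses (eta0 : 0 < eta <= 1) (etac : Ca * eta ^+ k <= c / 2).
Hypothesis (etaL : 1 <= eta * L).

(** By [etac] the removed part of the ball has at most half of the density bound as its measure; by
    [etaL] the points kept are at least as far from [K] as [x] is. *)
Definition far_shell (x : 'rV[R]_d) : set 'rV[R]_d :=
  [set y | enorm (y - x) < L * delta x /\ eta * L * delta x <= delta y].

(* Up to a constant, delta(x)^(-sp) times the average of |u|^p over far_shell x
   is the integral of transfer u (x, y) in y. *)
Definition transfer (u : 'rV[R]_d -> R) (z : 'rV[R]_d * 'rV[R]_d) : R :=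
  delta z.1 `^ (- sigma) * (`|u z.2| `^ p * \1_(far_shell z.1) z.2).

Let L0 : 0 < L.
Proof.
have /andP[e0' _] := eta0.
by rewrite -(pmulr_rgt0 _ e0'); exact: lt_le_trans etaL.
Qed.

Let mdelta D : measurable_fun D delta := measurable_dist_to K0 (D := D).

Lemma measurable_far_shell x : measurable (far_shell x).
Proof.
rewrite (_ : far_shell x = eball x (L * delta x) `\`
    [set y | delta y < eta * L * delta x]).
  apply: measurableD; first exact: measurable_eball.
  by apply: open_measurable_rV; exact: open_dist_to_lt.
apply/seteqP; split => y; rewrite /far_shell/eball/=.
  by move=> [? h]; split => //; apply/negP; rewrite -leNgt.
by move=> [? /negP]; rewrite -leNgt.
Qed.

Variable u : 'rV[R]_d -> R.
Hypothesis mu : measurable_fun setT u.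
Local Notation gag := (gagliardo_density s p Omega u).

Lemma transfer_ge0 z : 0 <= transfer u z.
Proof. by rewrite !mulr_ge0 ?powR_ge0. Qed.

Lemma measurable_transfer : measurable_fun setT (transfer u).
Proof.
apply: measurable_funM.
  apply: (measurableT_comp (measurable_powR _)).
  by apply: measurableT_comp; [exact: mdelta|exact: measurable_fst].
apply: measurable_funM.
  apply: (measurableT_comp (measurable_powR _)).
  apply: measurableT_comp; first exact: normr_measurable.
  by apply: measurableT_comp; [exact: mu|exact: measurable_snd].
pose A := [set z : 'rV[R]_d * 'rV[R]_d | far_shell z.1 z.2].
rewrite (_ : (fun _ => _) = \1_A).
  apply: measurable_indic.
  have mb : measurable_fun setT (fun z : 'rV[R]_d * 'rV[R]_d =>
     (enorm (z.1 - z.2) < L * delta z.1) && (eta * L * delta z.1 <= delta z.2)).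
    have m1 : measurable_fun setT (fun z : 'rV[R]_d * 'rV[R]_d => delta z.1).
      by apply: measurableT_comp; [exact: mdelta|exact: measurable_fst].
    have m2 : measurable_fun setT (fun z : 'rV[R]_d * 'rV[R]_d => delta z.2).
      by apply: measurableT_comp; [exact: mdelta|exact: measurable_snd].
    apply: measurable_and.
      by apply: measurable_fun_ltr;
        [exact: measurable_enormB|exact: measurable_funM].
    by apply: measurable_fun_ler => //; exact: measurable_funM.
  have := mb measurableT [set true] I; rewrite setTI; congr measurable.
  apply/seteqP; split => z; rewrite /A /far_shell/= enormB; first by move/andP.
  by move=> ?; apply/andP.
apply/funext => z; rewrite !indicE; congr (_%:R); apply/idP/idP; rewrite !inE//.
Qed.

(** This is [half_norm_split] for the part of [far_shell x] in [Omega], at radius [t = L * delta x],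
    after normalization. *)
Lemma hardy_pointwise x : 
  Omega x -> 0 < delta x -> L * delta x <= Num.min c e ->
  ((`|u x| `^ p * delta x `^ (- (s * p)))%:E <=
   (2 `^ p * (2 / c) * L `^ (s * p))%:E * gag x +
   (2 `^ p * (2 / c) * L ^- d)%:E *
   \int[leb]_(y in Omega) (transfer u (x, y))%:E)%E.
Proof.
move=> Ox x0; rewrite le_min => /andP[xc xe]; set t := L * delta x in xc xe *.
have /andP[eta_gt0 eta1] := eta0.
have t0 : 0 < t by rewrite mulr_gt0.
have td0 : 0 < t ^+ d by rewrite exprn_gt0.
pose E := Omega `&` far_shell x.
have mE : measurable E by apply: measurableI => //; exact: measurable_far_shell.
have Et : E `<=` eball x t by move=> y [_ []].
(* From the density at radius [t] one subtracts the [eta * t]-neighbourhood of [K], of measure at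
   most [Ca * eta ^ k * t ^ d] in the ball. *)
have Fge : ((c / 2 * t ^+ d)%:E <= leb E)%E.
  pose B := [set y | delta y < eta * t].
  have mB : measurable B by apply: open_measurable_rV; exact: open_dist_to_lt.
  have EB : E = (Omega `&` eball x t) `\` B.
    apply/seteqP; split => y; rewrite /E /B /far_shell/eball/= -mulrA -/t.
      by move=> [? [? h]]; split => //; apply/negP; rewrite -leNgt.
    by move=> [[? ?] /negP]; rewrite -leNgt.
  have := density Ox (_ : 0 < t <= c); rewrite t0 xc => /(_ isT).
  rewrite (@measureDI _ _ _ leb _ B)//; last first.
    by apply: measurableI => //; exact: measurable_eball.
  have CB : (leb ((Omega `&` eball x t) `&` B) <= (c / 2 * t ^+ d)%:E)%E.
    apply: (@le_trans _ _ (leb (eball x t `&` B))).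
      apply: le_measure; rewrite ?inE; last by move=> y [[]].
        by apply: measurableI => //; apply: measurableI => //;
          exact: measurable_eball.
      by apply: measurableI => //; exact: measurable_eball.
    apply: le_trans (codim _ _ _) _ => //.
      by rewrite mulr_gt0//= ler_piMl// ltW.
    have -> : Ca * (eta * t) ^+ k * t ^+ (d - k) = Ca * eta ^+ k * t ^+ d.
      by rewrite -[in RHS](subnKC kd) exprD exprMn; ring.
    by rewrite lee_fin ler_pM2r.
  rewrite {1}(splitr c) mulrDl EFinD -EB => h.
  have := le_trans h (leeD2l _ CB).
  by rewrite leeD2rE.
have EO : E `<=` Omega by move=> y [].
have := half_norm_split s0 p0 mO mu mE EO Et t0.
have b0 : (0 <= ((`|u x| / 2) `^ p)%:E)%E by rewrite lee_fin powR_ge0.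
move/(le_trans (lee_wpmul2l b0 Fge)) => {Fge b0}.
set I := (X in (_ + X)%E) => h.
have -> : (\int[leb]_(y in Omega) (transfer u (x, y))%:E =
    (delta x `^ (- sigma))%:E * I)%E.
  rewrite /I /E integral_mkcondr.
  rewrite -ge0_integralZl_EFin ?powR_ge0//.
  - apply: eq_integral => y _; rewrite /transfer patchE /= indicE EFinM.
    by case: ifPn => _; rewrite ?mulr1 ?mulr0.
  - by move=> y _; rewrite patchE; case: ifPn => // _; rewrite lee_fin powR_ge0.
  - apply/measurable_restrict => //; first exact: measurable_far_shell.
    exact: measurable_norm_powR.
(* [W] turns the left side into [|u x| ^ p * delta x ^ (- (s * p))]; it is also the coefficient of
   [I] in the goal. *)
pose W := 2 `^ p * (2 / c) * t ^- d * delta x `^ (- (s * p)).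
have W0 : (0 <= W%:E)%E.
  by rewrite lee_fin !mulr_ge0 ?powR_ge0 ?invr_ge0 ?exprn_ge0// ltW.
have I0 : (0 <= I)%E by apply: integral_ge0 => y _; rewrite lee_fin powR_ge0.
have := lee_wpmul2l W0 h.
rewrite ge0_muleDr ?mule_ge0 ?gagliardo_density_ge0 ?lee_fin ?powR_ge0//.
rewrite -!EFinM !muleA -!EFinM.
have -> : W * ((`|u x| / 2) `^ p * (c / 2 * t ^+ d)) =
    `|u x| `^ p * delta x `^ (- (s * p)).
  have h2 : 2^-1 `^ p = (2 `^ p)^-1 :> R.
    by rewrite -[in LHS]powR_inv1// -powRrM mulN1r powRN.
  rewrite powRM ?normr_ge0 ?invr_ge0// h2 /W.
  by field; rewrite !lt0r_neq0 ?powR_gt0.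
have -> : W * t `^ sigma = 2 `^ p * (2 / c) * L `^ (s * p).
  rewrite powR_sigma// /W /t powRN (powRM _ (ltW L0) (ltW x0)).
  by field; rewrite !lt0r_neq0 ?powR_gt0 ?mulr_gt0.
have -> : 2 `^ p * (2 / c) * L ^- d * delta x `^ (- sigma) = W.
  rewrite /W !powRN powR_sigma// /t exprMn.
  by field; rewrite !lt0r_neq0 ?powR_gt0 ?exprn_gt0.
by [].
Qed.

Variables (t0 eps : R).
Hypotheses (t00 : 0 < t0) (t0e : 2 * (1 + L) * t0 <= eta * e) (eps0 : 0 < eps).

(** Since [eta * L >= 1], mass is transferred only away from [K]. Hence the truncation at [eps] is
    inherited by [y], and the averages can be absorbed by the truncated integral itself. *)
Lemma transfer_eq0 x y : eps <=
  delta x -> delta y < eps -> transfer u (x, y) = 0.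
Proof.
move=> xe ye; rewrite /transfer/= indicE memNset ?mulr0//.
move=> [_]; apply/negP; rewrite -ltNge; apply: lt_le_trans ye _.
apply: (le_trans xe); rewrite ler_peMl//.
exact: le_trans (ltW eps0) xe.
Qed.

(** Of order [L ^ (d + s * p - k)]; the factor [L ^- d] in [hardy_pointwise] reduces it to
    [L ^ (s * p - k)]. *)
Let kappa := (1 + L) `^ sigma * Ca * (2 / eta) ^+ d * L ^- k.

(** If [y] lies in [far_shell x], then [delta y / (1 + L) <= delta x <= delta y / (eta * L)] and [x]
    is within [delta y / eta] of [y]. The lower bound controls the weight; the others confine [x] to
    a set measured by [codim]. *)
Lemma integral_transfer_le A y : measurable A ->
  (forall x, A x -> 0 < delta x < t0) -> 0 < delta y ->
  (\int[leb]_(x in A) (transfer u (x, y))%:E <=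
   (kappa * (`|u y| `^ p * delta y `^ (- (s * p))))%:E)%E.
Proof.
move=> mA At0 y0; have /andP[eta_gt0 eta1] := eta0.
have L1 : 1 <= L.
  by apply: le_trans etaL _; rewrite ler_piMl// ltW.
have sigma0 : 0 <= sigma by rewrite addr_ge0// mulr_ge0 ?ltW.
have kappa0 : 0 <= kappa.
  by rewrite !mulr_ge0 ?powR_ge0 ?invr_ge0 ?exprn_ge0// ?divr_ge0// ltW.
have rhs0 : (0 <= (kappa * (`|u y| `^ p * delta y `^ (- (s * p))))%:E)%E.
  by rewrite lee_fin mulr_ge0// mulr_ge0 ?powR_ge0.
(* For such [y] no [x] in [A] qualifies, as [delta y < (1 + L) * delta x < (1 + L) * t0]. The
   remaining [y] satisfy [rho <= e]. *)
have [yt|yt] := leP ((1 + L) * t0) (delta y).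
  rewrite integral0_eq// => x Ax.
  suff -> : transfer u (x, y) = 0 by [].
  rewrite /transfer/= indicE memNset ?mulr0// => -[xy _].
  have /andP[_ xt0] := At0 x Ax; have := dist_to_lip K0 y x; apply/negP.
  rewrite -ltNge; apply: lt_le_trans yt.
  apply: (@lt_trans _ _ ((1 + L) * delta x));
    last by rewrite ltr_pM2l// addr_gt0.
  by rewrite mulrDl mul1r addrC ltrD2l.
(* The factor 2 makes the weak bound on [delta x] strict. *)
pose r := 2 * delta y / (eta * L); pose rho := 2 * delta y / eta.
have r0 : 0 < r by rewrite divr_gt0 ?mulr_gt0.
have rho0 : 0 < rho by rewrite divr_gt0 ?mulr_gt0.
have rL : r * L = rho by rewrite /r /rho; field; rewrite !lt0r_neq0.
have rrho : r <= rho by rewrite -rL ler_peMr// ltW.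
have rhoe : rho <= e.
  rewrite ler_pdivrMr// mulrC (mulrC e); apply: le_trans t0e.
  by rewrite -mulrA mulrC ler_pM2l// ltW.
pose Z := eball y rho `&` [set x | delta x < r].
have mZ : measurable Z.
  apply: measurableI; first exact: measurable_eball.
  by apply: open_measurable_rV; exact: open_dist_to_lt.
pose W := ((1 + L) / delta y) `^ sigma * `|u y| `^ p.
have W0 : 0 <= W by rewrite mulr_ge0 ?powR_ge0.
apply: (@le_trans _ _ (\int[leb]_(x in A) (W%:E * (\1_Z x)%:E))%E).
  apply: ge0_le_integral => //.
  - by move=> x _; rewrite lee_fin transfer_ge0.
  - apply: measurable_funTS; apply/measurable_EFinP.
    by apply: (measurableT_comp measurable_transfer); exact: pair2_measurable.
  - apply: measurable_funeM; apply/measurable_EFinP.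
    exact: measurable_indic.
  move=> x Ax; rewrite -EFinM lee_fin /transfer/=.
  have [xy|nxy] := pselect (far_shell x y); last first.
    by rewrite (indicE _ (far_shell x)) memNset// !mulr0 mulr_ge0.
  have /andP[x0 xt0] := At0 x Ax; case: (xy) => xy1 xy2.
  have xr : delta x < r.
    rewrite ltr_pdivlMr ?mulr_gt0// mulrC; apply: le_lt_trans xy2 _; lra.
  have Zx : Z x.
    split => //; rewrite /eball/= enormB; apply: lt_trans xy1 _.
    by rewrite -rL mulrC ltr_pM2r.
  rewrite !indicE !mem_set// !mulr1 /W ler_wpM2r ?powR_ge0//.
  have -> : delta x `^ (- sigma) = (delta x)^-1 `^ sigma.
    by rewrite -[in RHS]powR_inv1 ?(ltW x0)// -powRrM mulN1r.
  apply: ge0_ler_powR; rewrite ?nnegrE ?invr_ge0//.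
  - exact: ltW.
  - by rewrite divr_ge0 ?(ltW y0)// addr_ge0// ltW.
  - rewrite ler_pdivlMr// mulrC ler_pdivrMr//.
    apply: le_trans (dist_to_lip K0 y x) _.
    by rewrite mulrDl mul1r addrC lerD2l ltW.
rewrite ge0_integralZl_EFin//; last first.
  by apply/measurable_EFinP; exact: measurable_indic.
rewrite integral_indic//.
have ZA : (leb (Z `&` A) <= (Ca * r ^+ k * rho ^+ (d - k))%:E)%E.
  apply: le_trans (codim y _ rhoe); last by rewrite r0 rrho.
  by apply: le_measure; rewrite ?inE//; exact: measurableI.
have W0' : (0 <= W%:E)%E by rewrite lee_fin.
apply: le_trans (lee_wpmul2l W0' ZA) _; rewrite -EFinM lee_fin.
rewrite le_eqVlt; apply/orP; left; apply/eqP.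
have -> : Ca * r ^+ k * rho ^+ (d - k) = Ca * (2 / eta) ^+ d * delta y ^+ d *
  L ^- k.
  have xd (z : R) : z ^+ d = z ^+ k * z ^+ (d - k) by rewrite -exprD subnKC.
  rewrite !xd.
  have -> : r = 2 / eta * delta y / L by rewrite /r; field; rewrite !lt0r_neq0.
  have -> : rho = 2 / eta * delta y by rewrite /rho; field; rewrite !lt0r_neq0.
  by rewrite !exprMn !exprVn; ring.
rewrite /W /kappa powRN powRM ?invr_ge0 ?addr_ge0 ?(ltW y0) ?(ltW L0)//.
have -> : (delta y)^-1 `^ sigma = (delta y ^+ d)^-1 * (delta y `^ (s * p))^-1.
  by rewrite -invfM -powR_sigma// -powR_inv1 ?(ltW y0)// -powRrM mulN1r powRN.
by field; rewrite !lt0r_neq0 ?powR_gt0 ?exprn_gt0.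
Qed.

(** Where [delta x < t0] the pointwise bound is integrated; its averages return at most half of [J],
    which is finite thanks to [eps] and can be subtracted. Elsewhere the weight is bounded. The
    resulting constant is free of [eps]. *)
Lemma hardy_truncated M : L * t0 <= Num.min c e ->
  2 `^ p * (2 / c) * L ^- d * kappa <= 2^-1 ->
  (\int[leb]_(x in Omega) gag x <= M%:E)%E ->
  (\int[leb]_(x in Omega) (`|u x| `^ p)%:E <= M%:E)%E ->
  (\int[leb]_(x in Omega `&` [set x | eps <= delta x]%R)
      (`|u x| `^ p * delta x `^ (- (s * p)))%:E <=
   (2 * (2 `^ p * (2 / c) * L `^ (s * p) + t0 `^ (- (s * p))) * M)%:E)%E.
Proof.
move=> Lt0 kap gM uM.
set B1 := 2 `^ p * (2 / c) * L `^ (s * p); set B2 := 2 `^ p * (2 / c) * L ^- d.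
set S := [set x | eps <= delta x]; set Y := Omega `&` S.
pose phi x := (`|u x| `^ p * delta x `^ (- (s * p)))%:E.
have sp0 : 0 < s * p by rewrite mulr_gt0.
have B10 : 0 <= B1 by rewrite mulr_ge0 ?powR_ge0//
  mulr_ge0 ?powR_ge0 ?divr_ge0// ltW.
have B20 : 0 <= B2.
  by rewrite !mulr_ge0 ?powR_ge0 ?invr_ge0 ?exprn_ge0// ltW.
have phi0 x : (0 <= phi x)%E by rewrite lee_fin mulr_ge0 ?powR_ge0.
have mphi D : measurable_fun D phi.
  apply: measurable_funTS; apply/measurable_EFinP; apply: measurable_funM.
    by apply/measurable_EFinP; exact: measurable_norm_powR.
  by apply: (measurableT_comp (measurable_powR _)); exact: mdelta.
have mS : measurable S.
  rewrite (_ : S = ~` [set x | delta x < eps]).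
    by apply: measurableC; apply: open_measurable_rV; exact: open_dist_to_lt.
  by apply/seteqP; split => x; rewrite /S/= leNgt; [move/negP|move=> ?;
    apply/negP].
have mY : measurable Y by exact: measurableI.
pose B := [set x | delta x < t0].
have mB : measurable B by apply: open_measurable_rV; exact: open_dist_to_lt.
have mYB : measurable (Y `&` B) by exact: measurableI.
have mYDB : measurable (Y `\` B) by exact: measurableD.
have M0 : 0 <= M.
  rewrite -lee_fin; apply: le_trans gM; apply: integral_ge0 => x _.
  exact: gagliardo_density_ge0.
(* Used with [eps] for the finiteness of [J], and with [t0] for the part far from [K]. *)
have far D e' : measurable D -> D `<=` Omega -> 0 < e' ->
    (forall x, D x -> e' <= delta x) ->
    (\int[leb]_(x in D) phi x <= (e' `^ (- (s * p)) * M)%:E)%E.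
  move=> mD DO e'0 De'.
  apply: (@le_trans _ _
      ((e' `^ (- (s * p)))%:E * \int[leb]_(x in D) (`|u x| `^ p)%:E)%E).
    rewrite -ge0_integralZl_EFin ?powR_ge0//; last exact: measurable_norm_powR.
    apply: ge0_le_integral => //.
      by apply: measurable_funeM; exact: measurable_norm_powR.
    move=> x Dx; rewrite /phi -EFinM lee_fin mulrC ler_wpM2r ?powR_ge0//.
    have x0 : 0 < delta x by exact: lt_le_trans (De' _ Dx).
    rewrite !powRN lef_pV2 ?posrE ?powR_gt0//.
    by apply: ge0_ler_powR; rewrite ?nnegrE ?(ltW sp0) ?(ltW e'0) ?(ltW x0)//;
      exact: De'.
  rewrite EFinM; apply: lee_wpmul2l; first by rewrite lee_fin powR_ge0.
  apply: le_trans uM; apply: ge0_subset_integral => //.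
  exact: measurable_norm_powR.
have mgag D : measurable_fun D gag.
  by apply: measurable_funTS; exact: measurable_gagliardo_density.
set J := (X in (X <= _)%E).
have J0 : (0 <= J)%E by apply: integral_ge0 => x _; exact: phi0.
have [j Jj] : exists j, J = j%:E.
  exists (fine J); rewrite fineK// ge0_fin_numE//.
  apply: le_lt_trans (far Y eps mY _ eps0 _) _; rewrite ?ltry//.
    by move=> x [].
  by move=> x [].
have JE : (J = \int[leb]_(x in Y `&` B) phi x +
    \int[leb]_(x in Y `\` B) phi x)%E.
  rewrite -ge0_integral_setU ?setUIDK//.
  by apply/disj_setPS => x [[_ h1] [_ h2]].
pose T x : \bar R := (\int[leb]_(y in Omega) (transfer u (x, y))%:E)%E.
have T0 x : (0 <= T x)%E by apply: integral_ge0 => y _;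
  rewrite lee_fin transfer_ge0.
have mT : measurable_fun setT T.
  by apply: measurable_integral_section => //;
    [exact: measurable_transfer|exact: transfer_ge0].
have near_int : (\int[leb]_(x in Y `&` B) phi x <=
    B1%:E * \int[leb]_(x in Y `&` B) gag x +
    B2%:E * \int[leb]_(x in Y `&` B) T x)%E.
  rewrite -!ge0_integralZl_EFin//; last 2 first.
  - exact: (measurable_funTS mT).
  - by move=> x _; exact: gagliardo_density_ge0.
  rewrite -ge0_integralD//; last 4 first.
  - by move=> x _; rewrite mule_ge0 ?gagliardo_density_ge0 ?lee_fin.
  - exact: measurable_funeM.
  - by move=> x _; rewrite mule_ge0 ?T0 ?lee_fin.
  - by apply: measurable_funeM; exact: (measurable_funTS mT).
  apply: ge0_le_integral => //.
    apply: emeasurable_funD; apply: measurable_funeM => //.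
    exact: (measurable_funTS mT).
  move=> x [[Ox Sx] Bx]; apply: hardy_pointwise => //.
    exact: lt_le_trans Sx.
  by apply: le_trans Lt0; rewrite ler_pM2l// ltW.
have gB : (\int[leb]_(x in Y `&` B) gag x <= M%:E)%E.
  apply: le_trans gM; apply: ge0_subset_integral => //.
    by move=> x _; exact: gagliardo_density_ge0.
  by move=> x [[]].
(* After the exchange of integrals the inner one vanishes for [delta y < eps], so the outer one is
   over the domain of [J]. *)
have TB : (\int[leb]_(x in Y `&` B) T x <= kappa%:E * J)%E.
  rewrite /T tonelli_restrict//; last 2 first.
  - exact: measurable_transfer.
  - exact: transfer_ge0.
  have kappa0 : 0 <= kappa.
    rewrite !mulr_ge0 ?powR_ge0 ?invr_ge0 ?exprn_ge0//; do ?exact: ltW.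
    by have /andP[? _] := eta0; rewrite divr_ge0// ltW.
  rewrite /J -ge0_integralZl_EFin//; last by move=> x _; exact: phi0.
  rewrite [X in (_ <= X)%E](@integral_mkcondr _ _ _ leb Omega S).
  apply: ge0_le_integral; first exact: mO.
  - by move=> y _; apply: integral_ge0 => x _; rewrite lee_fin transfer_ge0.
  - apply: measurable_funTS.
    apply: (@measurable_integral_section _ _ _ _ _ _ _
      (fun z => transfer u (z.2, z.1))) => //.
      by apply: (measurableT_comp measurable_transfer); exact: measurable_swap.
    by move=> z; exact: transfer_ge0.
  - apply/measurable_restrict => //.
    by apply: measurable_funeM.
  move=> y Oy; rewrite patchE; case: ifPn => [|/negP].
    rewrite inE => Sy; rewrite /phi -EFinM; apply: integral_transfer_le => //.
      by move=> x [[_ Sx] Bx]; rewrite (lt_le_trans eps0 Sx).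
    exact: lt_le_trans Sy.
  rewrite inE /S/= => /negP; rewrite -ltNge => yeps.
  rewrite integral0_eq// => x [[_ Sx] _].
  by rewrite (transfer_eq0 Sx yeps).
have DB : (\int[leb]_(x in Y `\` B) phi x <= (t0 `^ (- (s * p)) * M)%:E)%E.
  apply: far => //; first by move=> x [[]].
  by move=> x [_ /negP]; rewrite -leNgt.
have : (j%:E <= B1%:E * M%:E + B2%:E * (kappa%:E * j%:E) +
    (t0 `^ (- (s * p)) * M)%:E)%E.
  rewrite -Jj {1}JE; apply: leeD DB; apply: le_trans near_int _.
  by apply: leeD; apply: lee_wpmul2l => //; rewrite lee_fin.
rewrite -!EFinM -!EFinD lee_fin Jj lee_fin.
have j0 : 0 <= j by rewrite -lee_fin -Jj.
have : B2 * (kappa * j) <= j / 2.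
  by rewrite mulrA mulrC ler_wpM2l.
have -> : 2 * (B1 + t0 `^ (- (s * p))) * M =
  2 * (B1 * M) + 2 * (t0 `^ (- (s * p)) * M) by ring.
lra.
Qed.

End Hardy.

Section HardyInequality.
Context {R : realType} (d k : nat) (s p c Ca e : R) (Omega K : set 'rV[R]_d).
Hypotheses (s0 : 0 < s) (p0 : 0 < p) (c0 : 0 < c) (Ca0 : 0 < Ca) (e0 : 0 < e).
Hypotheses (k0 : (0 < k)%N) (kd : (k <= d)%N) (spk : s * p < k%:R).
Hypotheses (mO : measurable Omega) (K0 : K !=set0).
Local Notation leb := (@lebesgue_rV R d).
Local Notation delta := (dist_to K).
Local Notation sigma := (d%:R + s * p).
Hypothesis density : forall y t, Omega y -> 0 < t <= c ->
  ((c * t ^+ d)%:E <= leb (Omega `&` eball y t))%E.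
Hypothesis codim : forall y r rho, 0 < r <= rho -> rho <= e ->
  (leb (eball y rho `&` [set x | delta x < r]%R)
    <= (Ca * r ^+ k * rho ^+ (d - k))%:E)%E.

(** The parameters are fixed in the order [eta], [L], [t0], independently of [u] and [eps]. *)
Lemma hardy_inequality : exists2 C : R, 0 < C &
  forall (u : 'rV[R]_d -> R) (eps M : R), measurable_fun setT u -> 0 < eps ->
    (\int[leb]_(x in Omega) gagliardo_density s p Omega u x <= M%:E)%E ->
    (\int[leb]_(x in Omega) (`|u x| `^ p)%:E <= M%:E)%E ->
    (\int[leb]_(x in Omega `&` [set x | eps <= delta x]%R)
      (`|u x| `^ p * delta x `^ (- (s * p)))%:E <= (C * M)%:E)%E.
Proof.
(* As [eta <= 1] and [k > 0], one has [eta ^ k <= eta <= c / (2 * Ca)]. *)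
pose eta := Num.min 1 (c / (2 * Ca)).
have eta_gt0 : 0 < eta by rewrite lt_min ltr01 divr_gt0 ?mulr_gt0.
have eta1 : eta <= 1 by rewrite ge_min lexx.
have etac : Ca * eta ^+ k <= c / 2.
  apply: (@le_trans _ _ (Ca * eta)).
    by rewrite ler_pM2l// ler_iXnr// ltW.
  apply: (@le_trans _ _ (Ca * (c / (2 * Ca)))).
    by rewrite ler_pM2l// ge_min lexx orbT.
  by rewrite le_eqVlt; apply/orP; left; apply/eqP; field; rewrite lt0r_neq0.
have sp0 : 0 < s * p by rewrite mulr_gt0.
have sigma0 : 0 < sigma by rewrite ltr_wpDl.
pose C3 := 2 `^ p * (2 / c) * (2 `^ sigma * Ca * (2 / eta) ^+ d).
have C30 : 0 < C3.
  by rewrite /C3 !(mulr_gt0, powR_gt0, exprn_gt0, invr_gt0).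
(* The first entry gives [etaL]; the second makes the absorption factor, at most
   [C3 / L ^ (k - s * p)], no larger than one half. Here [s * p < k] is essential. *)
pose L := Num.max eta^-1 ((2 * C3) `^ (k%:R - s * p)^-1).
have Leta : eta^-1 <= L by rewrite le_max lexx.
have LC : (2 * C3) `^ (k%:R - s * p)^-1 <= L by rewrite le_max lexx orbT.
have L1 : 1 <= L by apply: le_trans Leta; rewrite invf_ge1.
have L0 : 0 < L by exact: lt_le_trans L1.
have etaL : 1 <= eta * L by rewrite mulrC -ler_pdivrMr// mul1r.
have ksp : 0 < k%:R - s * p by rewrite subr_gt0.
have kap : 2 `^ p * (2 / c) * L ^- d *
    ((1 + L) `^ sigma * Ca * (2 / eta) ^+ d * L ^- k) <= 2^-1.
  apply: (@le_trans _ _ (2 `^ p * (2 / c) * L ^- d *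
      ((2 * L) `^ sigma * Ca * (2 / eta) ^+ d * L ^- k))).
    rewrite ler_pM2l; last first.
      by rewrite !(mulr_gt0, powR_gt0, invr_gt0, exprn_gt0).
    rewrite -!(mulrA (_ `^ sigma)) ler_wpM2r//.
      by rewrite !mulr_ge0 ?invr_ge0 ?exprn_ge0 ?divr_ge0// ltW.
    apply: ge0_ler_powR; rewrite ?nnegrE ?(ltW sigma0)//.
    - by rewrite addr_ge0// ltW.
    - by rewrite mulr_ge0// ltW.
    - by rewrite mulrDl mul1r lerD2r.
  have -> : 2 `^ p * (2 / c) * L ^- d *
      ((2 * L) `^ sigma * Ca * (2 / eta) ^+ d * L ^- k) =
      C3 / L `^ (k%:R - s * p).
    rewrite powRM ?(ltW L0)// (powR_sigma d s p L0) powRB ?(gt_eqF L0)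
      ?implybT//.
    rewrite powR_mulrn ?(ltW L0)// /C3 exprMn exprVn.
    by field; rewrite !lt0r_neq0 ?powR_gt0 ?exprn_gt0.
  rewrite ler_pdivrMr ?powR_gt0// mulrC ler_pdivlMr// mulrC.
  have -> : 2 * C3 = ((2 * C3) `^ (k%:R - s * p)^-1) `^ (k%:R - s * p).
    by rewrite -powRrM mulVf ?gt_eqF// powRr1// mulr_ge0// ltW.
  by apply: ge0_ler_powR; rewrite ?nnegrE ?powR_ge0 ?(ltW L0) ?(ltW ksp).
pose t0 := Num.min (c / L) (eta * e / (2 * (1 + L))).
have L2 : 0 < 2 * (1 + L) by rewrite mulr_gt0// addr_gt0.
have t00 : 0 < t0 by rewrite lt_min divr_gt0//= divr_gt0// mulr_gt0.
have t0c : t0 <= c / L by rewrite ge_min lexx.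
have t0e : 2 * (1 + L) * t0 <= eta * e.
  by rewrite mulrC -ler_pdivlMr// ge_min lexx orbT.
have Lt0 : L * t0 <= Num.min c e.
  rewrite le_min mulrC -ler_pdivlMr// t0c/=.
  apply: (@le_trans _ _ (2 * (1 + L) * t0)).
    by rewrite (mulrC t0) ler_pM2r//; lra.
  by apply: le_trans t0e _; rewrite ler_piMl// ltW.
exists (2 * (2 `^ p * (2 / c) * L `^ (s * p) + t0 `^ (- (s * p)))).
  by rewrite mulr_gt0// addr_gt0 ?powR_gt0// !mulr_gt0 ?powR_gt0 ?invr_gt0.
move=> u eps M mu eps0 gM uM.
apply: (@hardy_truncated _ d k s p c Ca e Omega K _ _ _ _ _ _ _ _ _ eta L) =>
  //.
by rewrite eta_gt0.
Qed.

End HardyInequality.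

(** * Interpolation *)

Section NullSet.
Context {R : realType} (d k : nat) (Ca e : R) (K : set 'rV[R]_d).
Hypotheses (Ca0 : 0 < Ca) (e0 : 0 < e) (k0 : (0 < k)%N).
Hypotheses (K0 : K !=set0) (cK : closed K).
Local Notation leb := (@lebesgue_rV R d).
Hypothesis codim : forall y r rho, 0 < r <= rho -> rho <= e ->
  (leb (eball y rho `&` [set x | dist_to K x < r]%R)
    <= (Ca * r ^+ k * rho ^+ (d - k))%:E)%E.

Lemma measurable_closed_rV : measurable K.
Proof.
rewrite -[K]setCK; apply: measurableC; apply: open_measurable_rV.
exact: closed_openC.
Qed.

(** [K] lies in each of its [r]-neighbourhoods, whose measure in a fixed ball is at most a multiple
    of [r ^ k], with [k > 0]. *)
Lemma codim_null_eball y : leb (K `&` eball y e) = 0%E.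
Proof.
have mKe : measurable (K `&` eball y e).
  by apply: measurableI; [exact: measurable_closed_rV|exact: measurable_eball].
apply/eqP; rewrite eq_le measure_ge0 andbT; apply/lee_addgt0Pr => eps eps0.
rewrite add0e; pose b := Ca * e ^+ (d - k).
have b0 : 0 < b by rewrite mulr_gt0 ?exprn_gt0.
pose r := Num.min e (Num.min 1 (eps / b)).
have r0 : 0 < r by rewrite !lt_min e0 ltr01 divr_gt0.
have re : r <= e by rewrite ge_min lexx.
have r1 : r <= 1 by rewrite !ge_min lexx !orbT.
have rb : r <= eps / b by rewrite !ge_min lexx !orbT.
apply: (@le_trans _ _ (leb (eball y e `&` [set x | dist_to K x < r]%R))).
  apply: le_measure; rewrite ?inE//.
    apply: measurableI; first exact: measurable_eball.
    by apply: open_measurable_rV; exact: open_dist_to_lt.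
  by move=> x [Kx yx]; split => //=; rewrite dist_to_eq0.
apply: le_trans (codim _ _ _) _ => //; first by rewrite r0.
rewrite lee_fin mulrAC -/b mulrC; apply: (@le_trans _ _ (r * b)).
  by rewrite ler_pM2r// ler_iXnr// ltW.
by rewrite -ler_pdivlMr.
Qed.

(** The balls of radius [e] about rational points cover the space and are enumerated through
    [pickle]. *)
Lemma codim_null : leb K = 0%E.
Proof.
pose F n : set 'rV[R]_d := if unpickle n is Some q
  then K `&` eball (map_mx ratr (q : 'rV[rat]_d)) e else set0.
apply/negligibleP; first exact: measurable_closed_rV.
apply: (@negligibleS _ _ _ _ (\bigcup_n F n)) => [x Kx|].
  have /choice[q qx] (i : 'I_d) : exists q : rat, `|x 0 i - ratr q|
    < e / d.+1%:R.
    move: (e / d.+1%:R) (divr_gt0 e0 (ltr0Sn R d)) => r r0.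
    have [|q] := @rat_in_itvoo R (x 0 i - r) (x 0 i + r); first by lra.
    rewrite in_itv/= => /andP[h1 h2]; exists q; rewrite ltr_distl.
    by apply/andP; split; lra.
  exists (pickle (\row_i q i)) => //; rewrite /F pickleK; split => //.
  rewrite /eball/=; apply: (@le_lt_trans _ _ (d%:R * (e / d.+1%:R))).
    apply: enorm_le_coord => [|i]; first by rewrite divr_ge0// ltW.
    by rewrite !mxE ltW.
  by rewrite mulrCA gtr_pMr// ltr_pdivrMr// mul1r ltr_nat.
apply: negligible_bigcup => n; rewrite /F; case: unpickle => [q|].
  apply/negligibleP; last exact: codim_null_eball.
  by apply: measurableI; [exact: measurable_closed_rV|exact: measurable_eball].
exact: negligible_set0.
Qed.

End NullSet.

(** For [a > 0] the ratios of the two right-hand terms to the left side are the exponentials of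
    [(tau - p) * (- z)] and [(q - tau) * z], so the sign of [z] tells which term dominates. The
    powers of [m] make both terms scale alike after integration. *)
Lemma powR_interpolation {R : realType} (n w p q tau a t m : R) :
  0 < p -> w < n -> q = n * p / (n - w) -> p <= tau <= q ->
  0 <= a -> 0 < t -> 0 < m ->
  a `^ tau * t `^ (- (n + (w - n) * (tau / p))) <=
    m `^ ((tau - p) / p) * (a `^ p * t `^ (- w)) + m `^ ((tau - q) / p) * a
      `^ q.
Proof.
move=> p0 wn qE /andP[ptau tauq]; rewrite le_eqVlt => /orP[/eqP <-|a0] t0 m0.
  rewrite powR0 ?mul0r ?addr_ge0 ?mulr_ge0 ?powR_ge0// gt_eqF//.
  exact: lt_le_trans ptau.
set alpha := n + _.
pose z := ln a + (n - w) / p * ln t - ln m / p.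
have powE b y : 0 < b -> b `^ y = expR (y * ln b).
  by move=> b0; rewrite /powR gt_eqF.
have [z0|z0] := leP z 0.
  apply: le_trans (_ : _ <= m `^ ((tau - p) / p) * (a `^ p * t `^ (- w))) _.
    rewrite !powE// -!expRD ler_expR -subr_ge0.
    rewrite (_ : _ - _ = (tau - p) * (- z)).
      by rewrite mulr_ge0 ?subr_ge0// oppr_ge0.
    by rewrite /z /alpha; field; rewrite gt_eqF.
  by rewrite lerDl mulr_ge0 ?powR_ge0.
apply: le_trans (_ : _ <= m `^ ((tau - q) / p) * a `^ q) _.
  rewrite !powE// -!expRD ler_expR -subr_ge0.
  rewrite (_ : _ - _ = (q - tau) * z).
    by apply: mulr_ge0; [rewrite subr_ge0|exact: ltW].
  by rewrite /z /alpha qE; field; rewrite (gt_eqF p0) subr_eq0 gt_eqF.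
by rewrite lerDr !mulr_ge0 ?powR_ge0.
Qed.

(** Truncation from above is a contraction, so it cannot increase the Gagliardo integral. *)
Lemma dist_min_le {R : realDomainType} (a b N : R) :
  `|Num.min a N - Num.min b N| <= `|a - b|.
Proof.
have h x y : Num.min x N - Num.min y N <= `|x - y|.
  rewrite lerBlDr; have [yN|Ny] := leP y N.
    apply: (@le_trans _ _ x); first by rewrite ge_min lexx.
    by rewrite -lerBlDr ler_norm.
  by apply: (@le_trans _ _ N); [rewrite ge_min lexx orbT|rewrite lerDr].
by rewrite ler_norml h andbT lerNl opprB distrC h.
Qed.

(** * Hardy-Sobolev inequality by exhaustion of the complement of K *)

Section HardySobolev.
Context {R : realType} (d k : nat) (s p tau alpha : R).
Context (Omega K : set 'rV[R]_d).
Hypotheses (k0 : (0 < k)%N) (kd : (k <= d)%N) (s0 : 0 < s) (p0 : 0 < p).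
Hypotheses (lO : bounded_lipschitz_domain Omega).
Hypotheses (cK : compact_c01_codim k Omega K) (spk : s * p < k%:R).
Hypotheses (alphaE : alpha = d%:R + (s * p - d%:R) * (tau / p)).
Hypotheses (ptauq : p <= tau <= sobolev_exponent d s p).
Local Notation leb := (@lebesgue_rV R d).
Local Notation delta := (dist_to K).
Local Notation q := (sobolev_exponent d s p).

Lemma compact_c01_null : leb K = 0%E.
Proof.
have [Ca [e [Ca0 e0 codim]]] := codim_neighborhood kd cK.
have [K0 comK _] := cK; apply: codim_null codim => //.
exact: compact_closed.
Qed.

Let spd : s * p < d%:R.
Proof. by apply: lt_le_trans spk _; rewrite ler_nat. Qed.

(** The domain minus [K] is exhausted by sets [Y n] on which [u] and the weight are controlled; a
    bound uniform in [n] passes to the limit by monotone convergence. *)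
Lemma hardy_sobolev : exists2 C : R, 0 < C &
  forall (u : 'rV[R]_d -> R) (m : R), measurable_fun setT u -> 0 < m ->
    (\int[leb]_(x in Omega) gagliardo_density s p Omega u x <= m%:E)%E ->
    (\int[leb]_(x in Omega) (`|u x| `^ p)%:E <= m%:E)%E ->
    (\int[leb]_(x in Omega `\` K) (`|u x| `^ tau * delta x `^ (- alpha))%:E
      <= (C * m `^ (tau / p))%:E)%E.
Proof.
have [_ oO _ bO _] := lO; have [K0 comK _] := cK.
have mO : measurable Omega by exact: open_measurable_rV.
have clK : closed K by exact: compact_closed.
have finO := bounded_lebesgue_rV_lty bO mO.
have [c c0 density] := measure_density lO.
have [Ca [e [Ca0 e0 codim]]] := codim_neighborhood kd cK.
have [C1 C10 sob] := sobolev_bounded s0 p0 c0 spd mO density finO.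
have [C2 C20 hardy] := hardy_inequality s0 p0 c0 Ca0 e0 k0 kd spk mO K0
  density codim.
have q0 := sobolev_exponent_gt0 s0 p0 spd.
exists (C2 + C1); first exact: addr_gt0.
move=> u m mu m0 gu uu.
pose phi x := (`|u x| `^ tau * delta x `^ (- alpha))%:E.
have mdelta : measurable_fun setT delta by exact: measurable_dist_to.
have mpow r D : measurable_fun D (fun x => delta x `^ r).
  by apply: measurable_funTS; exact: (measurableT_comp (measurable_powR _)).
have phi0 x : (0 <= phi x)%E by rewrite lee_fin mulr_ge0 ?powR_ge0.
have mphi D : measurable_fun D phi.
  apply/measurable_EFinP; apply: measurable_funM => //.
  by apply/measurable_EFinP; exact: measurable_norm_powR.
(* [S n] supplies the [eps] of the truncated Hardy inequality; on [A n] truncating [|u|] at [n]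
   changes nothing. *)
pose S n := [set x | n.+1%:R^-1 <= delta x].
pose A (n : nat) := [set x | `|u x| <= n%:R].
pose Y n := (Omega `&` S n) `&` A n.
have mS n : measurable (S n).
  rewrite (_ : S n = ~` [set x | delta x < n.+1%:R^-1]).
    by apply: measurableC; apply: open_measurable_rV; exact: open_dist_to_lt.
  by apply/seteqP; split => x; rewrite /S/= leNgt; [move/negP|move=> ?;
    apply/negP].
have mA n : measurable (A n).
  rewrite (_ : A n = ~` [set x | n%:R < `|u x|]).
    by apply: measurableC; exact: measurable_norm_gt.
  by apply/seteqP; split => x; rewrite /A/= leNgt; [move/negP|move=> ?;
    apply/negP].
have mOS n : measurable (Omega `&` S n) by exact: measurableI.
have mY n : measurable (Y n) by exact: measurableI.
have YE : Omega `\` K = \bigcup_n Y n.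
  apply/seteqP; split => [x [Ox nKx]|x [n _ [[Ox Sx] _]]].
    have x0 := dist_to_gt0 K0 clK nKx.
    pose N := (Num.truncn (delta x)^-1 + Num.truncn `|u x| + 1)%N.
    have N1 : (delta x)^-1 < N.+1%:R.
      have := Num.Theory.truncnS_gt (delta x)^-1 => /lt_le_trans; apply.
      by rewrite ler_nat ltnS /N -addnA leq_addr.
    have N2 : `|u x| < N%:R.
      have := Num.Theory.truncnS_gt `|u x| => /lt_le_trans; apply.
      by rewrite ler_nat /N addn1 ltnS leq_addl.
    exists N => //; split; last exact: ltW.
    split => //; rewrite /S/= -[leRHS]invrK lef_pV2 ?posrE ?invr_gt0//.
    exact: ltW.
  split=> // Kx; move: Sx; rewrite /S/= dist_to_eq0// leNgt => /negP; apply.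
  by rewrite invr_gt0.
have ndY : nondecreasing_seq Y.
  move=> i j ij; apply/subsetPset => x [[Ox Sx] Ax]; split; first split => //.
    by apply: le_trans Sx; rewrite lef_pV2 ?posrE// ler_nat.
  by apply: le_trans Ax _; rewrite ler_nat.
rewrite YE.
have cvgY := ge0_nondecreasing_set_cvg_integral (mu := leb) ndY mY
  (fun n => mphi (Y n)) (fun n x _ => phi0 x).
rewrite -(cvg_lim _ cvgY)//.
apply: lime_le; first by apply/cvg_ex; eexists; exact: cvgY.
apply: nearW => n.
have SH := hardy u n.+1%:R^-1 m mu _ gu uu.
(* A bounded function, as the Sobolev inequality requires, that agrees with [|u|] on [Y n]. *)
pose v x := Num.min `|u x| n%:R.
have mv : measurable_fun setT v.
  by apply: measurable_minr => //; apply: measurableT_comp => //;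
    exact: normr_measurable.
have v0 x : 0 <= v x by rewrite le_min normr_ge0/=.
have vu x : v x <= `|u x| by rewrite ge_min lexx.
have vn x : v x <= n%:R by rewrite ge_min lexx orbT.
have vB x y : `|v x - v y| <= `|u x - u y|.
  by apply: le_trans (dist_min_le _ _ _) _; exact: ler_dist_dist.
have gv : (\int[leb]_(x in Omega) gagliardo_density s p Omega v x <= m%:E)%E.
  apply: le_trans gu; apply: ge0_le_integral; first exact: mO.
  - by move=> x _; exact: gagliardo_density_ge0.
  - by apply: measurable_funTS; exact: measurable_gagliardo_density.
  - by apply: measurable_funTS; exact: measurable_gagliardo_density.
  move=> x _; apply: ge0_le_integral => //.
  - by move=> y _; rewrite lee_fin gagliardo_kernel_ge0.
  - apply/measurable_funTS/measurable_EFinP.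
    exact: measurable_gagliardo_kernelr.
  - apply/measurable_funTS/measurable_EFinP.
    exact: measurable_gagliardo_kernelr.
  move=> y _; rewrite lee_fin /gagliardo_kernel ler_wpM2r ?invr_ge0 ?powR_ge0//.
  by apply: ge0_ler_powR; rewrite ?nnegrE ?(ltW p0).
have vv : (\int[leb]_(x in Omega) (`|v x| `^ p)%:E <= m%:E)%E.
  apply: le_trans uu; apply: ge0_le_integral => //.
  - exact: measurable_norm_powR.
  - exact: measurable_norm_powR.
  move=> x _; rewrite lee_fin; apply: ge0_ler_powR; rewrite ?nnegrE ?(ltW p0)//.
  by rewrite ger0_norm.
have SB : (\int[leb]_(x in Y n) (`|u x| `^ q)%:E <= (C1 * m `^ (q / p))%:E)%E.
  have vN x : Omega x -> `|v x| <= n%:R by rewrite ger0_norm.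
  apply: le_trans (sob v n%:R m mv (ler0n _ _) vN m0 gv vv).
  rewrite (eq_integral (fun x => (`|v x| `^ q)%:E)).
    apply: ge0_subset_integral => //; last by move=> x [[]].
    exact: measurable_norm_powR.
  move=> x; rewrite inE => -[_ Ax]; congr (_ `^ _)%:E.
  by rewrite (ger0_norm (v0 x)) /v min_l.
have mh D : measurable_fun D
    (fun x => (`|u x| `^ p * delta x `^ (- (s * p)))%:E).
  apply/measurable_EFinP; apply: measurable_funM => //.
  by apply/measurable_EFinP; exact: measurable_norm_powR.
have HB : (\int[leb]_(x in Y n) (`|u x| `^ p * delta x `^ (- (s * p)))%:E
    <= (C2 * m)%:E)%E.
  apply: le_trans (SH _); last by rewrite invr_gt0.
  apply: ge0_subset_integral => //.
  - exact: mOS.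
  - by move=> x _; rewrite lee_fin mulr_ge0 ?powR_ge0.
  - by move=> x [].
have mp0 r : 0 <= m `^ r by exact: powR_ge0.
(* Interpolation at scale [m]: by [HB] and [SB] each term contributes a multiple of
   [m ^ (tau / p)]. *)
apply: (@le_trans _ _ (\int[leb]_(x in Y n)
   ((m `^ ((tau - p) / p))%:E * (`|u x| `^ p * delta x `^ (- (s * p)))%:E +
    (m `^ ((tau - q) / p))%:E * (`|u x| `^ q)%:E))%E).
  apply: ge0_le_integral => //.
  - apply: emeasurable_funD; apply: measurable_funeM.
      exact: mh.
    exact: measurable_norm_powR.
  move=> x [[Ox Sx] _]; rewrite -!EFinM -EFinD lee_fin alphaE.
  apply: powR_interpolation => //.
  by apply: lt_le_trans Sx; rewrite invr_gt0.
rewrite ge0_integralD//; last 4 first.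
- by move=> x _; rewrite mule_ge0 ?lee_fin// mulr_ge0 ?powR_ge0.
- by apply: measurable_funeM; exact: mh.
- by move=> x _; rewrite mule_ge0 ?lee_fin ?powR_ge0.
- by apply: measurable_funeM; exact: measurable_norm_powR.
rewrite !ge0_integralZl_EFin//; last 2 first.
- exact: measurable_norm_powR.
- by move=> x _; rewrite lee_fin mulr_ge0 ?powR_ge0.
apply: le_trans (leeD (lee_wpmul2l _ HB) (lee_wpmul2l _ SB)) _;
  rewrite ?lee_fin//.
have -> : (C2 + C1) * m `^ (tau / p) = m `^ ((tau - p) / p) * (C2 * m) +
    m `^ ((tau - q) / p) * (C1 * m `^ (q / p)).
  have mD a b : m `^ a * m `^ b = m `^ (a + b).
    by rewrite powRD// (gt_eqF m0) implybT.
  have E1 : m `^ ((tau - p) / p) * m = m `^ (tau / p).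
    rewrite -[X in _ * X = _]powRr1 ?(ltW m0)// mD; congr (_ `^ _).
    by field; rewrite gt_eqF.
  have E2 : m `^ ((tau - q) / p) * m `^ (q / p) = m `^ (tau / p).
    by rewrite mD -mulrDl subrK.
  by rewrite (mulrCA _ C2) E1 (mulrCA _ C1) E2 mulrDl.
by [].
Qed.

End HardySobolev.

(** * From the integral inequality off K to the norm inequality on Omega *)

Theorem theorem2 (R : realType) (d k : nat) (s p tau alpha : R)
    (Omega K : set 'rV[R]_d) :
  (3 <= d)%N -> (1 < k < d)%N -> 0 < s < 1 -> 1 < p ->
  bounded_lipschitz_domain Omega ->
  K `<=` Omega -> compact_c01_codim k Omega K ->
  s * p < k%:R ->
  alpha = d%:R + (s * p - d%:R) * (tau / p) ->
  p <= tau <= sobolev_exponent d s p ->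
  exists2 C : R, 0 < C &
    forall u : 'rV[R]_d -> R, sobolev0 s p Omega K u ->
    ((\int[lebesgue_rV d]_(x in Omega)
        ((`|u x| `^ tau)%:E / (dist_to K x `^ alpha)%:E)) `^ tau^-1
     <= C%:E *
        (\int[lebesgue_rV d]_(x in Omega) \int[lebesgue_rV d]_(y in Omega)
           ((`|u x - u y| `^ p) / (enorm (x - y) `^ (d%:R + s * p)))%:E
         + \int[lebesgue_rV d]_(x in Omega) (`|u x| `^ p)%:E) `^ p^-1)%E.
Proof.
move=> _ /andP[k1 kd] /andP[s0 _] p1 lO _ cK spk alphaE ptauq.
have p0 : 0 < p by exact: lt_trans p1.
have k0 : (0 < k)%N by exact: ltnW.
have tau0 : 0 < tau by case/andP: ptauq => ptau _; exact: lt_le_trans ptau.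
have mO : measurable Omega by case: lO => _ oO _ _ _; exact: open_measurable_rV.
have [K0 comK _] := cK; have clK : closed K by exact: compact_closed.
have [C C0 HS] := hardy_sobolev k0 (ltnW kd) s0 p0 lO cK spk alphaE ptauq.
exists (C `^ tau^-1); first exact: powR_gt0.
move=> u [[mu Loo Goo] _].
(* [u] is measurable on [Omega] only, its extension by zero everywhere; the integrals over [Omega]
   are the same. *)
pose v := u \_ Omega.
have vE x : Omega x -> v x = u x by move=> Ox; rewrite /v patchE mem_set.
have mv : measurable_fun setT v by apply/(measurable_restrictT _ mO).
have mdelta : measurable_fun setT (dist_to K) by exact: measurable_dist_to.
set G := (\int[lebesgue_rV d]_(x in Omega) \int[lebesgue_rV d]_(y in Omega)
  _)%E.
set V := (\int[lebesgue_rV d]_(x in Omega) (`|u x| `^ p)%:E)%E.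
set I := (\int[lebesgue_rV d]_(x in Omega) _)%E.
have GE : (\int[lebesgue_rV d]_(x in Omega)
    gagliardo_density s p Omega v x = G)%E.
  apply: eq_integral => x /set_mem Ox; apply: eq_integral => y /set_mem Oy.
  by rewrite /gagliardo_kernel !vE.
have VE : (\int[lebesgue_rV d]_(x in Omega) (`|v x| `^ p)%:E = V)%E.
  by apply: eq_integral => x /set_mem Ox; rewrite vE.
have G0 : (0 <= G)%E.
  rewrite -GE; apply: integral_ge0 => x _; exact: gagliardo_density_ge0.
have V0 : (0 <= V)%E by apply: integral_ge0 => x _; rewrite lee_fin powR_ge0.
have GVoo : (G + V < +oo)%E by exact: lte_add_pinfty.
clear Loo Goo; clearbody G V.
have [M [M0 ME]] : exists M, 0 <= M /\ (G + V = M%:E)%E.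
  exists (fine (G + V)); split; first by apply: fine_ge0; exact: adde_ge0.
  by rewrite fineK// ge0_fin_numE//; exact: adde_ge0.
(* The extended-real inverse of 0 is [+oo], so the integrand may be infinite on [K]; as [K] is null
   it can be removed, and off [K] the quotient is a real product. *)
have IE : (I = \int[lebesgue_rV d]_(x in Omega `\` K)
    (`|v x| `^ tau * dist_to K x `^ (- alpha))%:E)%E.
  pose g x := ((`|v x| `^ tau)%:E / (dist_to K x `^ alpha)%:E)%E.
  have -> : I = (\int[lebesgue_rV d]_(x in Omega) g x)%E.
    by apply: eq_integral => x /set_mem Ox; rewrite /g vE.
  rewrite (ge0_negligible_integral (measurable_closed_rV clK))//.
  - apply: eq_integral => x /set_mem[Ox nKx].
    have x0 := dist_to_gt0 K0 clK nKx.
    by rewrite /g inver gt_eqF ?powR_gt0// -EFinM powRN.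
  - apply: emeasurable_funM; first exact: measurable_norm_powR.
    rewrite (_ : (fun _ => _) = fun x => if dist_to K x `^ alpha == 0 then +oo%E
        else (dist_to K x `^ alpha)^-1%:E); last first.
      by apply/funext => x; rewrite inver.
    have ma r : measurable_fun Omega (fun x => dist_to K x `^ r).
      by apply: measurable_funTS; exact: (measurableT_comp (measurable_powR _)).
    apply: measurable_fun_if => //; first exact: measurable_fun_eqr.
    apply: (@measurable_funS _ _ _ _ Omega) => //.
    apply/measurable_EFinP; under eq_fun do rewrite -powRN; exact: ma.
  - by move=> x _; rewrite /g mule_ge0 ?inve_ge0 ?lee_fin ?powR_ge0.
  - exact: (compact_c01_null k0 (ltnW kd) cK).
have bound m : 0 < m -> M <= m -> (I <= (C * m `^ (tau / p))%:E)%E.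
  move=> m0 Mm; rewrite IE; apply: HS => //.
    rewrite GE; apply: (@le_trans _ _ (G + V)%E); first by rewrite leeDl.
    by rewrite ME lee_fin.
  rewrite VE; apply: (@le_trans _ _ (G + V)%E); first by rewrite leeDr.
  by rewrite ME lee_fin.
have taup : 0 < tau / p by rewrite divr_gt0.
(* The previous bound asks for [m > 0], so [M = 0] is reached through small [m], chosen with
   [C * m ^ (tau / p) = eps]. *)
have {}bound : (I <= (C * M `^ (tau / p))%:E)%E.
  have [Mgt0|] := ltP 0 M; first exact: bound.
  move=> Mle0; have -> : M = 0 by apply/eqP; rewrite eq_le Mle0 M0.
  rewrite powR0 ?gt_eqF// mulr0; apply/lee_addgt0Pr => eps eps0; rewrite add0e.
  have Ce : 0 < eps / C by rewrite divr_gt0.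
  apply: le_trans (bound ((eps / C) `^ (tau / p)^-1) _ _) _.
  - exact: powR_gt0.
  - exact: le_trans Mle0 (powR_ge0 _ _).
  rewrite -powRrM mulVf ?gt_eqF// powRr1 ?(ltW Ce)//.
  by rewrite mulrCA divff ?mulr1 ?gt_eqF.
rewrite ME poweR_EFin -EFinM.
have tauV : 0 <= tau^-1 by rewrite invr_ge0 ltW.
have I0 : (0 <= I)%E.
  by rewrite IE; apply: integral_ge0 => x _; rewrite lee_fin mulr_ge0 ?powR_ge0.
have R0 : (0 <= (C * M `^ (tau / p))%:E)%E.
  by rewrite lee_fin mulr_ge0 ?powR_ge0// ltW.
apply: le_trans (gt0_ler_poweR tauV _ _ bound) _.
- by rewrite in_itv/= I0 leey.
- by rewrite in_itv/= R0 leey.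
rewrite poweR_EFin lee_fin powRM ?powR_ge0 ?(ltW C0)// -powRrM.
by rewrite (_ : tau / p / tau = p^-1)//; field; rewrite !gt_eqF.
Qed.
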